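(* Suppose that $n\geq 0$, and that $z_{ij}\in\mathbb{T}$ for $i,j=1,\dotsc,n$ are such that $z_{ji}=\overline{z_{ij}}$ for all $i,j=1,\dotsc,n$ with $i\neq j$. Suppose that $0\leq l\leq n$, and let $\mathcal A$ denote the universal unital $C^*$-algebra that is generated by isometries $s_1,\dotsc,s_l$ and unitaries $s_{l+1},\dotsc,s_n$ such that $s_i^*s_j=\overline{z_{ij}}\,s_js_i^*$ for $i,j=1,\dotsc,n$ with $i\neq j$. Suppose that $n'\geq n$, and that $z'_{ij}\in\mathbb{T}$ for $i,j=1,\dotsc,n'$ are such that $z'_{ji}=\overline{z'_{ij}}$ for all $i,j=1,\dotsc,n'$ with $i\neq j$, and $z'_{ij}=z_{ij}$ for all $i,j=1,\dotsc,n$ with $i\neq j$. Suppose that $n\leq k\leq n'$, and let $\mathcal A'$ denote the universal unital $C^*$-algebra that is generated by isometries $s'_1,\dotsc,s'_l$, unitaries $s'_{l+1},\dotsc,s'_n$, isometries $s'_{n+1},\dotsc,s'_k$, and unitaries $s'_{k+1},\dotsc,s'_{n'}$ such that $s_i'^{*}s'_j=\overline{z'_{ij}}\,s'_js_i'^{*}$ for $i,j=1,\dotsc,n'$ with $i\neq j$. Then the unique unital $*$-homomorphism $\psi:\mathcal A\to\mathcal A'$ such that $\psi(s_i)=s'_i$ for $i=1,\dotsc,n$ is injective.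
   Context: $\mathbb{T}$ is the unit circle in $\mathbb{C}$. An isometry in a unital $C^*$-algebra is an element $s$ with $s^*s=1$; a unitary is an element $s$ with $s^*s=ss^*=1$. *)

(* Defs.v *)
From HB Require Import structures.
From mathcomp Require Import all_boot all_order all_algebra.
From mathcomp Require Import complex.
From mathcomp Require Import boolp classical_sets reals topology normedtype.
From mathcomp Require Import sequences.

Set Implicit Arguments.
Unset Strict Implicit.
Unset Printing Implicit Defensive.

Import Order.TTheory GRing.Theory Num.Theory.
Import numFieldNormedType.Exports.

Local Open Scope classical_set_scope.
Local Open Scope ring_scope.
Local Open Scope complex_scope.

(* The Banach norm is R-valued and part of the mixin: Hierarchy Builder refuses
   to join [GRing.Algebra] with [CompleteNormedModule], since [Num.NumDomain]
   already inherits from both the ring and the normed hierarchies.  Completeness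
   is stated for Cauchy sequences; [0 <= cnorm a] follows from the axioms. *)
HB.mixin Record isCstarAlgebra (R : realType) A of GRing.Algebra R[i] A := {
  cnorm : A -> R ;
  cnorm_eq0 : forall a : A, cnorm a = 0 -> a = 0 ;
  cnormD : forall a b : A, cnorm (a + b) <= cnorm a + cnorm b ;
  cnormZ : forall (c : R[i]) (a : A),
    cnorm (c *: a) = ComplexField.Normc.normc c * cnorm a ;
  cnormM : forall a b : A, cnorm (a * b) <= cnorm a * cnorm b ;
  cnorm_complete : forall u : A ^nat,
    (forall e : R, 0 < e ->
       \forall m \near \oo & p \near \oo, cnorm (u m - u p) < e) ->
    exists a : A, cnorm (u m - a) @[m --> \oo] --> (0 : R) ;
  star : A -> A ;
  starK : involutive star ;
  starD : {morph star : a b / a + b} ;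
  starZ : forall (c : R[i]) (a : A), star (c *: a) = Num.conj c *: star a ;
  starM : forall a b : A, star (a * b) = star b * star a ;
  cnorm_star : forall a : A, cnorm (star a * a) = cnorm a ^+ 2
}.

(* Unital C*-algebras; [GRing.Algebra] includes [1 != 0], so the zero algebra
   is excluded. *)
#[short(type="cstarAlgType")]
HB.structure Definition CstarAlgebra (R : realType) :=
  {A of GRing.Algebra R[i] A & isCstarAlgebra R A}.

Section CstarAlgebraDefs.
Variable R : realType.
Implicit Types A B : cstarAlgType R.

Definition isometry A (s : A) : Prop := star s * s = 1.

Definition unitary A (s : A) : Prop := star s * s = 1 /\ s * star s = 1.

Definition unital_star_hom A B (f : A -> B) : Prop :=
  [/\ linear f, monoid_morphism f & {morph f : a / star a}].

Definition cnorm_closed A (S : {pred A}) : Prop :=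
  forall (u : A ^nat) (a : A), (forall m, u m \in S) ->
    cnorm (u m - a) @[m --> \oo] --> (0 : R) -> a \in S.

(* Generation as a unital C*-algebra. *)
Definition generates A n (s : 'I_n -> A) : Prop :=
  forall S : {pred A},
    subalg_closed S -> {in S, forall a, star a \in S} -> cnorm_closed S ->
    (forall i, s i \in S) -> forall a, a \in S.

(* [u] selects the indices of the generators required to be unitary. *)
Definition twisted_relations n (z : 'I_n -> 'I_n -> R[i]) (u : pred 'I_n)
    A (s : 'I_n -> A) : Prop :=
  (forall i, if u i then unitary (s i) else isometry (s i)) /\
  (forall i j, i != j ->
     star (s i) * s j = Num.conj (z i j) *: (s j * star (s i))).

Definition universal_cstar_algebra n (z : 'I_n -> 'I_n -> R[i]) (u : pred 'I_n)
    A (s : 'I_n -> A) : Prop :=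
  [/\ twisted_relations z u s,
      generates s &
      forall (B : cstarAlgType R) (t : 'I_n -> B), twisted_relations z u t ->
        exists! phi : A -> B,
          unital_star_hom phi /\ (forall i, phi (s i) = t i)].

End CstarAlgebraDefs.

(* Main.v *)
(* If some C*-algebra contains elements satisfying the relations of [A'] and receives an
   injective unital *-homomorphism from [A] sending the [s i] to the first [n] of them,
   then this homomorphism factors through [psi], so [psi] is injective.  Such an algebra
   is reached by adjoining the missing generators one at a time, each of them as a
   unitary.  Given elements [t i] of [B], consider adjointable operators on a Hilbert
   [B]-module of functions on the integers: let [t i] act by the diagonal operator with
   coefficients [zeta_i ^ k * t i], where [zeta_i = z' i p] for the new index [p], and let
   the new generator be the bilateral shift.  The universal property of [A] provides a
   homomorphism into these operators, and its diagonal coefficient at [0] is the previous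
   homomorphism, so injectivity persists.

   The norm of these operators satisfies the C*-identity by the Cauchy-Schwarz inequality
   for finite sums [sum x_i* y_i] in [B], hence by the positivity of [x* x].  Spectra are
   not needed for this: a self-adjoint [a] is positive when [|t - a| <= t] for some real
   [t], a condition stable under sums, and positive elements have square roots obtained
   by iteration. *)

From HB Require Import structures.
From mathcomp Require Import ssrAC all_boot all_order all_algebra.
From mathcomp Require Import complex zify ring lra.
From mathcomp Require Import boolp classical_sets functions reals topology normedtype.
From mathcomp Require Import sequences.
Require Import Defs.

Set Implicit Arguments.
Unset Strict Implicit.
Unset Printing Implicit Defensive.

Import Order.TTheory GRing.Theory Num.Theory.
Import numFieldNormedType.Exports.

Local Open Scope ring_scope.
Local Open Scope complex_scope.

Local Notation normc := Normc.normc.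
Local Notation "t *r a" := (t%:C *: a) (at level 40, left associativity).

(** * Norm and involution *)

Section Norm.
Variables (R : realType) (A : cstarAlgType R).
Implicit Types (a b x y : A) (t : R).

Lemma normc_real t : normc t%:C = `|t|.
Proof. by rewrite /= expr0n /= addr0 sqrtr_sqr. Qed.

Lemma normc_ge0 (c : R[i]) : 0 <= normc c.
Proof. by case: c => x y; exact: sqrtr_ge0. Qed.

Lemma normc_unit (c : R[i]) : `|c| = 1 -> normc c = 1.
Proof. by case. Qed.

Lemma conjC_real t : Num.conj (t%:C) = t%:C.
Proof. by rewrite conj_Creal //; apply/complex_realP; exists t. Qed.

Lemma cnormZr t a : cnorm (t *r a) = `|t| * cnorm a.
Proof. by rewrite cnormZ normc_real. Qed.

Lemma cnorm0 : cnorm (0 : A) = 0.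
Proof. by rewrite -(scale0r (0 : A)) cnormZ Normc.normc0 mul0r. Qed.

Lemma cnormN a : cnorm (- a) = cnorm a.
Proof. by rewrite -scaleN1r cnormZ normcN Normc.normc1 mul1r. Qed.

Lemma cnorm_ge0 a : 0 <= cnorm a.
Proof. by have := cnormD a (- a); rewrite subrr cnorm0 cnormN; lra. Qed.

Lemma cnormB a b : cnorm (a - b) <= cnorm a + cnorm b.
Proof. by rewrite -(cnormN b) cnormD. Qed.

Lemma cnormBC a b : cnorm (a - b) = cnorm (b - a).
Proof. by rewrite -cnormN opprB. Qed.

Lemma cnorm_triangle b a c : cnorm (a - c) <= cnorm (a - b) + cnorm (b - c).
Proof. by have := cnormD (a - b) (b - c); rewrite addrA subrK. Qed.

Lemma cnorm_le0 a : cnorm a <= 0 -> a = 0.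
Proof. by move=> h; apply: cnorm_eq0; apply/eqP; rewrite eq_le h cnorm_ge0. Qed.

Lemma cnorm_small a : (forall e : R, 0 < e -> cnorm a <= e) -> a = 0.
Proof. by move=> h; apply: cnorm_le0; apply/ler_addgt0Pr => e e0; rewrite add0r h. Qed.

Lemma star0 : star (0 : A) = 0.
Proof. by apply: (addrI (star 0)); rewrite -starD !addr0. Qed.

Lemma starN a : star (- a) = - star a.
Proof. by apply: (addrI (star a)); rewrite -starD !subrr star0. Qed.

Lemma starB a b : star (a - b) = star a - star b.
Proof. by rewrite starD starN. Qed.

Lemma starZr t a : star (t *r a) = t *r star a.
Proof. by rewrite starZ conjC_real. Qed.

Lemma star1 : star (1 : A) = 1.
Proof. by have := starM (star (1 : A)) 1; rewrite mulr1 starK mulr1. Qed.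

Lemma star_sum I (r : seq I) (F : I -> A) :
  star (\sum_(i <- r) F i) = \sum_(i <- r) star (F i).
Proof. by elim/big_rec2: _ => [|i x y _ <-]; rewrite ?star0 ?starD. Qed.

Lemma cnorm1 : cnorm (1 : A) = 1.
Proof.
have := cnorm_star (1 : A); rewrite star1 mulr1 => h.
have [/cnorm_eq0/eqP|n0] := eqVneq (cnorm (1 : A)) 0; first by rewrite oner_eq0.
by apply: (mulfI n0); rewrite mulr1 -expr2 -h.
Qed.

Lemma cnorm_starE a : cnorm (star a) = cnorm a.
Proof.
have le b : cnorm b <= cnorm (star b).
  have := cnormM (star b) b; rewrite cnorm_star.
  have [->|n0] := eqVneq (cnorm b) 0; first by rewrite cnorm_ge0.
  by rewrite expr2 ler_pM2r // lt_def n0 cnorm_ge0.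
by apply/eqP; rewrite eq_le le -{2}(starK a) le.
Qed.

Lemma cnorm_sqr_sa a : star a = a -> cnorm (a * a) = cnorm a ^+ 2.
Proof. by move=> sa; rewrite -cnorm_star sa. Qed.

Lemma sqr_sa_eq0 a : star a = a -> a * a = 0 -> a = 0.
Proof.
move=> sa a0; apply: cnorm_eq0; apply/eqP.
by rewrite -sqrf_eq0 -cnorm_sqr_sa // a0 cnorm0.
Qed.

(** A form of completeness that keeps the rate: when one index goes to infinity, the limit inherits
    every Cauchy estimate at once, with a non-strict bound. *)
Lemma cnorm_limit (u : nat -> A) :
  (forall e : R, 0 < e ->
     exists N, forall m n, (N <= m)%N -> (N <= n)%N -> cnorm (u m - u n) <= e) ->
  exists a, forall e N,
    (forall m n, (N <= m)%N -> (N <= n)%N -> cnorm (u m - u n) <= e) ->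
    forall n, (N <= n)%N -> cnorm (u n - a) <= e.
Proof.
move=> uC; have [|a ua] := @cnorm_complete R A u.
  move=> e e0; have [|N hN] := uC (e / 2); first by rewrite divr_gt0.
  near=> m p; apply: (@le_lt_trans _ _ (e / 2)); last by lra.
  have Nm : (N <= m)%N by near: m; exact: nbhs_infty_ge.
  have Np : (N <= p)%N by near: p; exact: nbhs_infty_ge.
  exact: hN.
exists a => d N hN n Nn; apply/ler_addgt0Pr => e e0.
move/cvgrPdist_lt: ua => /(_ e e0)[N' _ hN'].
have := hN' (maxn n N') (leq_maxr _ _).
rewrite /= sub0r normrN ger0_norm ?cnorm_ge0 // => h.
have := cnorm_triangle (u (maxn n N')) (u n) a.
have := hN n (maxn n N') Nn (leq_trans Nn (leq_maxl _ _)); lra.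
Unshelve. all: by end_near. Qed.

Lemma cnorm_cvg0 (u : nat -> A) a :
  (cnorm (u m - a) @[m --> \oo] --> (0 : R))%classic ->
  forall e, 0 < e -> exists N, forall n, (N <= n)%N -> cnorm (u n - a) <= e.
Proof.
move=> /cvgrPdist_le h e e0; have [N _ hN] := h e e0.
by exists N => n /hN; rewrite /= sub0r normrN ger0_norm ?cnorm_ge0.
Qed.

End Norm.

(** * Positivity *)

Section Positive.
Variables (R : realType) (A : cstarAlgType R).
Implicit Types (a b c h p q x y : A) (t : R).

Definition pos a := star a = a /\ exists t, cnorm (t *r 1 - a) <= t.

Lemma realcD (s t : R) a : (s + t) *r a = s *r a + t *r a.
Proof. by rewrite rmorphD scalerDl. Qed.

Lemma realcN t a : (- t) *r a = - (t *r a).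
Proof. by rewrite rmorphN scaleNr. Qed.

Lemma realcM (s t : R) a : (s * t) *r a = s *r (t *r a).
Proof. by rewrite rmorphM scalerA. Qed.

Lemma posD a b : pos a -> pos b -> pos (a + b).
Proof.
move=> [sa [s hs]] [sb [t ht]]; split; first by rewrite starD sa sb.
exists (s + t); rewrite realcD opprD addrACA.
by apply: (le_trans (cnormD _ _)); rewrite lerD.
Qed.

Lemma pos0 : pos 0.
Proof. by split; [rewrite star0 | exists 0; rewrite scale0r subrr cnorm0]. Qed.

Lemma pos_sum I (r : seq I) (F : I -> A) :
  (forall i, pos (F i)) -> pos (\sum_(i <- r) F i).
Proof. by move=> h; elim/big_ind: _ => //; [exact: pos0 | exact: posD]. Qed.

Lemma posZ t a : 0 <= t -> pos a -> pos (t *r a).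
Proof.
move=> t0 [sa [s hs]]; split; first by rewrite starZr sa.
exists (t * s); rewrite realcM -scalerBr cnormZr ger0_norm //.
by rewrite ler_wpM2l.
Qed.

Lemma pos_norm_sub t a : star a = a -> cnorm a <= t -> pos (t *r 1 - a).
Proof.
move=> sa at_; split; first by rewrite starB starZr star1 sa.
by exists t; rewrite opprB addrC subrK.
Qed.

(* [y = (x + y ^ 2) / 2] iff [(1 - y) ^ 2 = 1 - x].  The iterates are polynomials in [x]
   with nonnegative coefficients, so [|x| <= 1] lets the scalar iteration at [x = 1]
   dominate them. *)
Fixpoint sqrt_scalar (n : nat) : R :=
  if n is n'.+1 then (1 + sqrt_scalar n' ^+ 2) / 2 else 0.

Fixpoint sqrt_seq x (n : nat) : A :=
  if n is n'.+1 then 2^-1 *r (x + sqrt_seq x n' * sqrt_seq x n') else 0.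

Lemma sqrt_scalar_itv n : 0 <= sqrt_scalar n <= 1.
Proof. by elim: n => [|n /andP[h0 h1]] /=; rewrite ?lexx ?ler01 //; nra. Qed.

(** The defect [d = 1 - sqrt_scalar n] is replaced at each step by [d - d ^ 2 / 2], which decays
    like [2 / n]; this explicit rate makes the iterates in [A] Cauchy. *)
Lemma sqrt_scalar_rate n : (1 - sqrt_scalar n) * (n%:R + 2) <= 2.
Proof.
elim: n => [|n IH] /=; first by lra.
have /andP[h0 h1] := sqrt_scalar_itv n; rewrite -[n.+1%:R]natr1.
move: IH (ler0n R n); move: h0 h1; set d := 1 - sqrt_scalar n.
have -> : sqrt_scalar n = 1 - d by rewrite /d; ring.
move: (n%:R) => r h0 h1 IH r0.
have -> : 1 - (1 + (1 - d) ^+ 2) / 2 = d - d ^+ 2 / 2 by field.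
have p0 : 0 <= 2 - d * (r + 2) by lra.
(* With [p = 2 - d * (r + 2)], the right side minus the left side is exactly [p * (r + p / 2)]. *)
have k1 : (r + 2) ^+ 2 * (d - d ^+ 2 / 2) <= 2 * (r + 1).
  have := mulr_ge0 p0 (addr_ge0 r0 (divr_ge0 p0 (ler0n R 2))); nra.
have k2 : 0 < (r + 2) ^+ 2 by rewrite exprn_gt0 // ltr_wpDl.
rewrite -(ler_pM2l k2) mulrA.
have r3 : 0 <= r + 1 + 2 by lra.
by apply: (le_trans (ler_wpM2r r3 k1)); nra.
Qed.

Lemma sqrt_scalar_mono m n : (m <= n)%N -> sqrt_scalar m <= sqrt_scalar n.
Proof.
elim: n m => [|n IH] m; first by rewrite leqn0 => /eqP ->.
rewrite leq_eqVlt => /predU1P[->//|]; rewrite ltnS => /IH h.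
apply: (le_trans h) => /=.
have := sqr_ge0 (1 - sqrt_scalar n); nra.
Qed.

Lemma sqrt_seq_comm x c n : c * x = x * c -> c * sqrt_seq x n = sqrt_seq x n * c.
Proof.
move=> cx; elim: n => [|n IH] /=; first by rewrite mulr0 mul0r.
by rewrite -scalerAr -scalerAl mulrDr mulrDl cx mulrA IH -mulrA IH mulrA.
Qed.

Lemma sqrt_seq_sa x n : star x = x -> star (sqrt_seq x n) = sqrt_seq x n.
Proof.
by move=> sx; elim: n => [|n IH] /=; rewrite ?star0 // starZr starD starM IH sx.
Qed.

Lemma sqrt_seq_norm x n : cnorm x <= 1 -> cnorm (sqrt_seq x n) <= sqrt_scalar n.
Proof.
move=> x1; elim: n => [|n IH] /=; first by rewrite cnorm0.
rewrite cnormZr ger0_norm ?invr_ge0 // mulrC ler_pM2r ?invr_gt0 //.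
apply: (le_trans (cnormD _ _)); apply: lerD => //.
by apply: (le_trans (cnormM _ _)); rewrite expr2 ler_pM ?cnorm_ge0.
Qed.

(** Since iterates commute, [y1 ^ 2 - y0 ^ 2] factors as [(y1 - y0) * (y1 + y0)], as it does for
    scalars, so the domination propagates from one increment to the next. *)
Lemma sqrt_seq_step x n : cnorm x <= 1 ->
  cnorm (sqrt_seq x n.+1 - sqrt_seq x n) <= sqrt_scalar n.+1 - sqrt_scalar n.
Proof.
move=> x1; elim: n => [|n IH].
  rewrite /= mulr0 !(addr0, subr0) cnormZr ger0_norm ?invr_ge0 // expr0n /= addr0.
  by rewrite mulrC ler_pM2r ?invr_gt0.
set y1 := sqrt_seq x n.+1 in IH *; set y0 := sqrt_seq x n in IH *.
set d1 := sqrt_scalar n.+1 in IH *; set d0 := sqrt_scalar n in IH *.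
have -> : sqrt_seq x n.+2 - y1 = 2^-1 *r ((y1 - y0) * (y1 + y0)).
  have yC : y0 * y1 = y1 * y0 by apply: sqrt_seq_comm; rewrite -sqrt_seq_comm.
  rewrite {2}/y1 /= -/y1 -/y0 -scalerBr; congr (_ *: _).
  by rewrite mulrDr !mulrBl yC opprD addrACA subrr add0r addrA subrK.
have -> : sqrt_scalar n.+2 - d1 = 2^-1 * ((d1 - d0) * (d1 + d0)).
  have d1E : d1 = (1 + d0 ^+ 2) / 2 by [].
  have -> : sqrt_scalar n.+2 = (1 + d1 ^+ 2) / 2 by [].
  by rewrite [X in _ - X = _]d1E; field.
rewrite cnormZr ger0_norm ?invr_ge0 // ler_pM2l ?invr_gt0 //.
apply: (le_trans (cnormM _ _)); apply: ler_pM; rewrite ?cnorm_ge0 //.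
by apply: (le_trans (cnormD _ _)); apply: lerD; apply: sqrt_seq_norm.
Qed.

(** The increments are dominated by those of a convergent scalar sequence; the fixed-point equation
    and the other properties of the iterates pass to the limit. *)
Lemma sqrt_one_sub x : star x = x -> cnorm x <= 1 ->
  exists y, [/\ star y = y, cnorm y <= 1, (1 - y) * (1 - y) = 1 - x
    & forall c, c * x = x * c -> c * y = y * c].
Proof.
move=> sx x1; pose d n : R := 2 / (n%:R + 2).
have dP n : 1 - sqrt_scalar n <= d n.
  by rewrite /d ler_pdivlMr ?sqrt_scalar_rate // ltr_wpDl.
have d0 e : 0 < e -> exists N, forall n, (N <= n)%N -> d n <= e.
  move=> e0; exists (Num.truncn (2 / e)).+1 => n hn.
  have : 2 / e < n%:R.
    by apply: (lt_le_trans (truncnS_gt _ : 2 / e < _)); rewrite ler_nat.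
  rewrite ltr_pdivrMr // /d => h; rewrite ler_pdivrMr ?ltr_wpDl //; nra.
have ymn m n : (m <= n)%N ->
    cnorm (sqrt_seq x n - sqrt_seq x m) <= sqrt_scalar n - sqrt_scalar m.
  elim: n => [|n IH]; first by rewrite leqn0 => /eqP ->; rewrite !subrr cnorm0.
  rewrite leq_eqVlt => /predU1P[->|]; first by rewrite !subrr cnorm0.
  rewrite ltnS => /IH h; have := sqrt_seq_step n x1.
  by have := cnorm_triangle (sqrt_seq x n) (sqrt_seq x n.+1) (sqrt_seq x m); lra.
have [y yP] : exists y, forall n, cnorm (sqrt_seq x n - y) <= d n.
  have yd i m n : (i <= m)%N -> (i <= n)%N ->
      cnorm (sqrt_seq x m - sqrt_seq x n) <= d i.
    wlog mn : m n / (m <= n)%N => [hw pm pn|pm _].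
      by case/orP: (leq_total m n) => ?; [|rewrite cnormBC]; exact: hw.
    rewrite cnormBC; have := ymn _ _ mn; have := dP i; have := sqrt_scalar_mono pm.
    by have /andP[_] := sqrt_scalar_itv n; lra.
  have [|y yP] := @cnorm_limit R A (sqrt_seq x).
    by move=> e /d0[N hN]; exists N => m n Nm Nn; apply: le_trans (hN N _); [exact: yd|].
  by exists y => n; apply: yP (leqnn n) => m p; exact: yd.
(* Each property of [y] below comes down to a quantity bounded by a constant [C] times [d n];
   dividing by [C + 1] also covers [C = 0]. *)
have lim (f : nat -> R) C : (forall n, f n <= C * d n) -> 0 <= C -> forall e, 0 < e ->
    exists n, f n <= e.
  move=> fd C0 e e0; have [|N hN] := d0 (e / (C + 1)).
  - by rewrite divr_gt0 // ltr_wpDl.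
  - exists N; have := hN N (leqnn _); rewrite ler_pdivlMr ?ltr_wpDl // => h.
    have : 0 <= d N by rewrite /d divr_ge0 // addr_ge0.
    by have := fd N; nra.
have y1 : cnorm y <= 1.
  apply/ler_addgt0Pr => e /(lim (fun n => d n) 1)[n|//|n hn]; first by rewrite mul1r.
  have := cnorm_triangle (sqrt_seq x n) y 0; rewrite !subr0 (cnormBC y).
  have := sqrt_seq_norm n x1; have /andP[_] := sqrt_scalar_itv n; have := yP n; lra.
exists y; split => //.
- apply/eqP; rewrite -subr_eq0; apply/eqP; apply: cnorm_small => e.
  move=> /(lim (fun n => cnorm (star y - y)) 2)[n|//|//].
  have := cnorm_triangle (sqrt_seq x n) (star y) y.
  rewrite -{1}(sqrt_seq_sa n sx) -starB cnorm_starE (cnormBC y); have := yP n; lra.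
- suff e2 : y * y = y + (y - x).
    rewrite mulrBl mul1r mulrBr mulr1 e2 opprB [y + (y - x)]addrC addrK.
    by rewrite addrA subrK.
  apply/eqP; rewrite addrA -subr_eq opprK -subr_eq0; apply/eqP; apply: cnorm_small => e.
  move=> /(lim (fun n => cnorm (y * y + x - (y + y))) 4)[n|//|//].
  (* With [y_n = sqrt_seq x n], [x] is eliminated through [x = 2 y_(n+1) - y_n ^ 2]; the three terms
     have norms at most [d n], [d n] and [2 * d n.+1], hence the constant 4. *)
  have -> : y * y + x - (y + y) =
      (y - sqrt_seq x n) * y + sqrt_seq x n * (y - sqrt_seq x n)
      + 2 *r (sqrt_seq x n.+1 - y).
    rewrite [sqrt_seq x n.+1]/= scalerBr -realcM divff ?pnatr_eq0 //.
    rewrite realcD rmorph1 !scale1r.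
    by rewrite mulrBl mulrBr [x + _]addrC !addrA !subrK.
  have k1 := cnormD ((y - sqrt_seq x n) * y + sqrt_seq x n * (y - sqrt_seq x n))
    (2 *r (sqrt_seq x n.+1 - y)).
  apply: (le_trans k1); rewrite cnormZr ger0_norm //.
  have k2 := cnormD ((y - sqrt_seq x n) * y) (sqrt_seq x n * (y - sqrt_seq x n)).
  have k3 := cnormM (y - sqrt_seq x n) y.
  have k4 := cnormM (sqrt_seq x n) (y - sqrt_seq x n).
  have k5 := yP n; have k6 := yP n.+1.
  have k7 : d n.+1 <= d n.
    by rewrite /d ler_pM2l // lef_pV2 ?posrE ?ltr_wpDl // lerD2r ler_nat.
  have k8 := sqrt_seq_norm n x1; have /andP[_ k9] := sqrt_scalar_itv n.
  have k10 := cnorm_ge0 (y - sqrt_seq x n); have k11 := cnorm_ge0 (sqrt_seq x n).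
  rewrite cnormBC in k5; nra.
- move=> c cx; apply/eqP; rewrite -subr_eq0; apply/eqP; apply: cnorm_small => e.
  move=> /(lim (fun n => cnorm (c * y - y * c)) (2 * cnorm c))[n||//]; last first.
    by rewrite mulr_ge0 ?cnorm_ge0.
  have -> : c * y - y * c = c * (y - sqrt_seq x n) - (y - sqrt_seq x n) * c.
    by rewrite mulrBr mulrBl (sqrt_seq_comm n cx) opprB addrA subrK.
  apply: (le_trans (cnormB _ _)).
  have := cnormM c (y - sqrt_seq x n); have := cnormM (y - sqrt_seq x n) c.
  have := yP n; rewrite cnormBC; have := cnorm_ge0 c; nra.
Qed.
End Positive.

(** * Square roots, norm order and positivity of [star x * x] *)

Section PositiveCone.
Variables (R : realType) (A : cstarAlgType R).
Implicit Types (a b c h p q x y : A) (t : R).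

(** After scaling, [1 - a / t] has norm at most 1 and [sqrt_one_sub] applies. The commutation clause
    supplies the commuting pairs to which [cnorm_sqr_le_commute] is applied. *)
Lemma pos_sqrt a : pos a ->
  exists b, [/\ pos b, b * b = a & forall c, c * a = a * c -> c * b = b * c].
Proof.
move=> [sa [t ht]]; have t0 : 0 <= t by apply: le_trans ht; rewrite cnorm_ge0.
have [t_eq0|tn0] := eqVneq t 0.
  have a0 : a = 0 by apply: cnorm_le0; move: ht; rewrite t_eq0 scale0r sub0r cnormN.
  exists 0; split; [exact: pos0 | by rewrite mul0r |].
  by move=> c _; rewrite mulr0 mul0r.
have [||y [sy y1 yy yC]] := @sqrt_one_sub R A (t^-1 *r (t *r 1 - a)).
- by rewrite starZr starB starZr star1 sa.
- by rewrite cnormZr ger0_norm ?invr_ge0 // ler_pdivrMl ?mulr1 // lt_def tn0.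
have xE : 1 - t^-1 *r (t *r 1 - a) = t^-1 *r a.
  by rewrite scalerBr -realcM mulVf // rmorph1 scale1r subKr.
exists (Num.sqrt t *r (1 - y)); split.
- apply: posZ; first exact: sqrtr_ge0.
  split; first by rewrite starB star1 sy.
  by exists 1; rewrite rmorph1 scale1r subKr.
- rewrite -scalerAl -scalerAr -realcM -expr2 sqr_sqrtr // yy xE.
  by rewrite -realcM divff // rmorph1 scale1r.
- move=> c ca; rewrite -scalerAl -scalerAr; congr (_ *: _).
  rewrite mulrBl mulrBr mul1r mulr1 yC // -scalerAl -scalerAr mulrBl mulrBr ca.
  by rewrite -scalerAl -scalerAr mul1r mulr1.
Qed.

(* [b * b + c * c = x* x] for [x = b + i c], and [2 b = x + x*]. *)
Lemma cnorm_sqr_le_commute b c : star b = b -> star c = c -> b * c = c * b ->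
  cnorm b ^+ 2 <= cnorm (b * b + c * c).
Proof.
move=> sb sc bc; pose x := b + 'i *: c.
have sx : star x = b - 'i *: c.
  rewrite starD starZ sb sc -scaleNr; congr (_ + _ *: _).
  by apply/eqP; rewrite eq_complex /= oppr0 !eqxx.
have -> : b * b + c * c = star x * x.
  rewrite sx mulrDr !mulrBl -!scalerAr -!scalerAl bc scalerA.
  have -> : 'i * 'i = -1 :> R[i] by rewrite -expr2 sqr_i.
  by rewrite scaleN1r opprK addrA subrK.
rewrite cnorm_star ler_sqr ?nnegrE ?cnorm_ge0 //.
have e : 2 *r b = x + star x by rewrite sx addrACA subrr addr0 realcD !rmorph1 !scale1r.
have := cnormD x (star x); rewrite -e cnormZr cnorm_starE ger0_norm //; lra.
Qed.

(* If [|h| <= 1] then [1 - h ^ 2] has a square root [k] commuting with [h], and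
   [|1 - h ^ 2| = |k| ^ 2 <= |h ^ 2 + k ^ 2| = 1]. *)
Lemma pos_sqr h : star h = h -> pos (h * h).
Proof.
move=> sh; have N : cnorm (h * h) <= cnorm h ^+ 2 by rewrite cnorm_sqr_sa.
have [|k [[sk _] kk kC]] := pos_sqrt (pos_norm_sub _ N).
  by rewrite starM sh.
split; first by rewrite starM sh.
exists (cnorm h ^+ 2); rewrite -kk cnorm_sqr_sa //.
have hk : h * k = k * h.
  by apply: kC; rewrite mulrBl mulrBr -scalerAl -scalerAr mul1r mulr1 mulrA.
have := cnorm_sqr_le_commute sk sh (esym hk).
by rewrite kk subrK cnormZr cnorm1 mulr1 ger0_norm ?exprn_ge0 ?cnorm_ge0.
Qed.

(** Roots [b] of [a] and [c] of [- a] commute and [b ^ 2 + c ^ 2 = 0], which bounds [|b| ^ 2 = |a|]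
    by 0. *)
Lemma pos_anti a : pos a -> pos (- a) -> a = 0.
Proof.
move=> pa pna; have [b [[sb _] bb bC]] := pos_sqrt pa.
have [c [[sc _] cc cC]] := pos_sqrt pna.
have cb : c * b = b * c by apply: bC; rewrite -[a]opprK -cc mulrN mulNr mulrA.
have := cnorm_sqr_le_commute sb sc (esym cb); rewrite bb cc subrr cnorm0.
by rewrite -cnorm_sqr_sa // bb => /cnorm_le0.
Qed.

(** Commuting roots of [p] and [t - p] have squares with sum [t], and [|p|] is the squared norm of
    the first root. *)
Lemma pos_cnorm_le_real t p : 0 <= t -> pos p -> pos (t *r 1 - p) -> cnorm p <= t.
Proof.
move=> t0 pp pq; have [b [[sb _] bb bC]] := pos_sqrt pp.
have [c [[sc _] cc cC]] := pos_sqrt pq.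
have cb : b * c = c * b.
  apply: cC; rewrite mulrBl mulrBr -scalerAl -scalerAr mul1r mulr1 -bb.
  by rewrite mulrA.
have := cnorm_sqr_le_commute sb sc cb.
rewrite -cnorm_sqr_sa // bb cc addrC subrK cnormZr cnorm1 mulr1.
by rewrite ger0_norm.
Qed.

(** [|q| - p] is the sum of the positive elements [|q| - q] and [q - p]. *)
Lemma pos_cnorm_le p q : pos p -> pos (q - p) -> cnorm p <= cnorm q.
Proof.
move=> pp pqp; apply: pos_cnorm_le_real => //; first exact: cnorm_ge0.
have -> : cnorm q *r 1 - p = (cnorm q *r 1 - q) + (q - p) by rewrite addrA subrK.
apply: posD => //; apply: pos_norm_sub => //.
by case: pp pqp => sp _ [+ _]; rewrite starB sp => /addIr.
Qed.

(** Up to sign, [u] and [v] are twice the real and imaginary parts of [y]; in [u ^ 2 + v ^ 2] the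
    squares of [y] and of [star y] cancel. *)
Lemma pos_star_add y : pos (star y * y + y * star y).
Proof.
set u := y + star y; set v := 'i *: (y - star y).
have su : star u = u by rewrite starD starK addrC.
have ii : 'i * 'i = -1 :> R[i] by rewrite -expr2 sqr_i.
have sv : star v = v.
  rewrite starZ starB starK /v -(opprB y) scalerN -scaleNr; congr (_ *: _).
  by apply/eqP; rewrite eq_complex /= oppr0 opprK !eqxx.
have e : u * u + v * v = 2 *r (star y * y + y * star y).
  rewrite /v -scalerAl -scalerAr scalerA ii scaleN1r /u realcD rmorph1 scale1r.
  rewrite !mulrDl !mulrDr !mulrN !mulNr !opprD !opprK.
  rewrite [LHS](AC ((2*2)*(2*2)) (((1*5)*(4*8))*((3*2)*(7*6)))) /=.
  by rewrite !subrr !add0r.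
have -> : star y * y + y * star y = 2^-1 *r (u * u + v * v).
  by rewrite e -realcM mulVf ?pnatr_eq0 // rmorph1 scale1r.
by apply: posZ; rewrite ?invr_ge0 //; apply: posD; apply: pos_sqr.
Qed.

(* Kaplansky's argument: with [m = |x* x|], the negative part of [x* x] is half of
   [c = m - x* x], and [y = x c] satisfies [y* y = - d^2].  Then [y y*] is positive and
   [w = y d] has both [w* w] and [w w*] negative, which forces [d = 0] and [c = 0]. *)
Lemma pos_starM x : pos (star x * x).
Proof.
set a := star x * x; have sa : star a = a by rewrite starM starK.
have [m [pm mm mC]] := pos_sqrt (pos_sqr sa).
(* The root [r] of [m] turns [c * a * c = - c ^ 2 * m] into minus the square of the self-adjoint
   [d = c * r]. *)
have [r [[sr _] rr rC]] := pos_sqrt pm.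
have am : a * m = m * a by apply: mC; rewrite mulrA.
have ar : a * r = r * a by apply: rC.
set c := m - a; have sc : star c = c by case: pm => sm _; rewrite starB sm sa.
have cm : c * m = m * c by rewrite mulrBl mulrBr am.
have rc : c * r = r * c by apply: rC.
have ac : a * c = - (m * c) by rewrite /c !mulrBr opprB mm am.
set d := c * r; have sd : star d = d by rewrite starM sr sc -rc.
have dd : d * d = c * c * m by rewrite /d {2}rc mulrA -(mulrA c) rr -mulrA -cm mulrA.
set y := x * c.
have yy : star y * y = - (d * d).
  rewrite starM sc mulrA -(mulrA c) -/a dd -(mulrA c a) -(mulrA c c) -mulrN; congr (c * _).
  by rewrite ac cm.
have py : pos (y * star y).
  rewrite -[y * _](addKr (star y * y)) yy opprK; apply: posD; first exact: pos_sqr.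
  by rewrite -yy; exact: pos_star_add.
set w := y * d.
have ww : star w * w = - ((d * d) * (d * d)).
  by rewrite /w (starM y) sd mulrA -(mulrA d (star y)) yy mulrN mulNr !mulrA.
have ww' : w * star w = - ((y * star y) * (y * star y)).
  by rewrite /w (starM y) sd [LHS]mulrA -(mulrA y d d) -[d * d]opprK -yy mulrN mulNr !mulrA.
have p1 : pos ((d * d) * (d * d)) by apply: pos_sqr; rewrite starM sd.
have p2 : pos ((y * star y) * (y * star y)) by apply: pos_sqr; rewrite starM starK.
(* The sum is positive as a sum of squares, and its negative is [star w * w + w * star w], positive
   too. *)
have e : (d * d) * (d * d) + (y * star y) * (y * star y) = 0.
  apply: pos_anti; first exact: posD.
  by rewrite opprD -ww -ww'; exact: pos_star_add.
have d0 : (d * d) * (d * d) = 0.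
  by apply: pos_anti => //; move/eqP: e; rewrite addrC addr_eq0 => /eqP <-.
have d1 : d * d = 0 by apply: sqr_sa_eq0 d0; rewrite starM sd.
(* From [c ^ 2 = 2 m c], the fourth power of [c] is [2 c ^ 2 m c = 2 d ^ 2 c = 0]. *)
have cc : c * c = m * c + m * c by rewrite {1}/c mulrBl ac opprK.
have c0 : c = 0.
  apply: sqr_sa_eq0 => //; apply: sqr_sa_eq0; first by rewrite starM sc.
  by rewrite {2}cc mulrDr mulrA -dd d1 mul0r addr0.
by move/eqP: c0; rewrite subr_eq0 => /eqP <-.
Qed.

Lemma pos_conj c p : pos p -> pos (star c * p * c).
Proof.
move=> /pos_sqrt[b [[sb _] <- _]].
have -> : star c * (b * b) * c = star (b * c) * (b * c) by rewrite starM sb !mulrA.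
exact: pos_starM.
Qed.

Lemma pos_scale_sub t p : pos p -> cnorm p <= t -> pos (t *r 1 - p).
Proof. by move=> [sp _]; exact: pos_norm_sub. Qed.

(* With [a], [b], [c] the Gram elements of [(x, x)], [(y, y)], [(x, y)], expand the Gram
   element of [x c - t y] and use [c* a c <= t c* c] for [t > |a|]. *)
Lemma cauchy_schwarz I (r : seq I) (x y : I -> A) :
  cnorm (\sum_(i <- r) star (x i) * y i) ^+ 2 <=
  cnorm (\sum_(i <- r) star (x i) * x i) * cnorm (\sum_(i <- r) star (y i) * y i).
Proof.
set a := \sum_(i <- r) star (x i) * x i; set b := \sum_(i <- r) star (y i) * y i.
set c := \sum_(i <- r) star (x i) * y i.
have pa : pos a by apply: pos_sum => i; exact: pos_starM.
(* Taking [t] strictly above [|a|] keeps it invertible when [a = 0]; letting [t] decrease to [|a|]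
   recovers the claim. *)
suff key t : cnorm a < t -> cnorm c ^+ 2 <= t * cnorm b.
  apply/ler_addgt0Pr => e e0; have b0 := cnorm_ge0 b.
  have e1 : 0 < e / (cnorm b + 1) by rewrite divr_gt0 // ltr_wpDl.
  apply: (le_trans (key (cnorm a + e / (cnorm b + 1)) _)); first by rewrite ltrDl.
  have e2 : e / (cnorm b + 1) * (cnorm b + 1) = e by rewrite divfK // gt_eqF // ltr_wpDl.
  nra.
move=> at_; have t0 : 0 < t by apply: le_lt_trans at_; rewrite cnorm_ge0.
have scE : star c = \sum_(i <- r) star (y i) * x i.
  by rewrite star_sum; apply: eq_bigr => i _; rewrite starM starK.
have e : \sum_(i <- r) star (x i * c - t *r y i) * (x i * c - t *r y i) =
    star c * a * c - t *r (star c * c) - t *r (star c * c) + (t * t) *r b.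
  have e1 : star c * c = \sum_(i <- r) star c * (star (x i) * y i) by rewrite -mulr_sumr.
  have e2 : star c * c = \sum_(i <- r) star (y i) * x i * c by rewrite -mulr_suml -scE.
  rewrite {1}e1 e2 /a /b mulr_sumr mulr_suml !scaler_sumr -!sumrB -big_split.
  apply: eq_bigr => i _ /=.
  rewrite starB starM starZr mulrBl !mulrBr opprB -!scalerAl -!scalerAr -realcM !mulrA.
  by rewrite [LHS](AC (2*2) ((1*2)*(4*3))) /= addrA.
have p1 : pos (star c * a * c - t *r (star c * c) - t *r (star c * c) + (t * t) *r b).
  by rewrite -e; apply: pos_sum => i; exact: pos_starM.
have p2 := pos_conj c (pos_scale_sub pa (ltW at_)).
(* Adding [star c * (t - a) * c] to the Gram element leaves [t] times the element sought. *)
have p3 : pos (t *r b - star c * c).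
  have -> : t *r b - star c * c = t^-1 *r
      ((star c * a * c - t *r (star c * c) - t *r (star c * c) + (t * t) *r b)
      + star c * (t *r 1 - a) * c).
    have -> : star c * (t *r 1 - a) * c = t *r (star c * c) - star c * a * c.
      by rewrite mulrBr mulrBl -scalerAr mulr1 -scalerAl.
    rewrite [X in t^-1 *r X](AC (4*2) ((4*2)*((1*6)*(3*5)))) /= subrr addNr !addr0.
    by rewrite -scalerN realcM -scalerDr -realcM mulVf ?gt_eqF // rmorph1 scale1r.
  by apply: posZ; [rewrite invr_ge0 ltW | exact: posD].
rewrite -cnorm_star; apply: (le_trans (pos_cnorm_le (pos_starM c) p3)).
by rewrite cnormZr gtr0_norm.
Qed.

End PositiveCone.

(** * Homomorphisms are contractive *)

Section Hom.
Variables (R : realType) (A B : cstarAlgType R) (f : A -> B).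
Hypothesis fH : unital_star_hom f.

Lemma hom_linear : linear f. Proof. by case: fH. Qed.
Lemma hom1 : f 1 = 1. Proof. by case: fH => _ h _; exact: h.1. Qed.
Lemma homM a b : f (a * b) = f a * f b. Proof. by case: fH => _ h _; exact: h.2. Qed.
Lemma hom_star a : f (star a) = star (f a). Proof. by case: fH. Qed.
Lemma homD a b : f (a + b) = f a + f b.
Proof. by have := hom_linear 1 a b; rewrite !scale1r. Qed.
Lemma hom0 : f 0 = 0. Proof. by apply: (addrI (f 0)); rewrite -homD !addr0. Qed.
Lemma homZ (k : R[i]) a : f (k *: a) = k *: f a.
Proof. by have := hom_linear k a 0; rewrite hom0 !addr0. Qed.
Lemma homB a b : f (a - b) = f a - f b.
Proof. by rewrite homD -scaleN1r homZ scaleN1r. Qed.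

(** For [p = star a * a], the element [|p| - p] is a square, so its image is positive and
    [|f p| <= |p|]. This continuity carries identities from generators to the closure. *)
Lemma hom_cnorm_le a : cnorm (f a) <= cnorm a.
Proof.
rewrite -ler_sqr ?nnegrE ?cnorm_ge0 // -!cnorm_star -hom_star -homM.
set p := star a * a; have pp : pos p := pos_starM a.
apply: pos_cnorm_le_real; first exact: cnorm_ge0.
  by rewrite homM hom_star; exact: pos_starM.
have [b [[sb _] bb _]] := pos_sqrt (pos_scale_sub pp (lexx _)).
by rewrite -hom1 -homZ -homB -bb homM; apply: pos_sqr; rewrite -hom_star sb.
Qed.

End Hom.

(** * The Hilbert module *)

Section Window.
Variables (R : realType) (A : cstarAlgType R).
Implicit Types (f g : int -> A) (a : int) (b : nat).

(** The [A]-valued inner product on the window [[a, a + b)], conjugate-linear in [f]; only finite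
    sums are ever formed. *)
Definition gram f g a b : A :=
  \sum_(0 <= i < b) star (f (a + i%:Z)) * g (a + i%:Z).

Definition wnorm f a b : R := Num.sqrt (cnorm (gram f f a b)).

Lemma gramDr f g h a b : gram f (g + h) a b = gram f g a b + gram f h a b.
Proof. by rewrite -big_split; apply: eq_bigr => i _; exact: mulrDr. Qed.

Lemma gramZr (k : R[i]) f g a b : gram f (k *: g) a b = k *: gram f g a b.
Proof. by rewrite scaler_sumr; apply: eq_bigr => i _; rewrite [LHS]/= scalerAr. Qed.

Lemma gram_star f g a b : star (gram f g a b) = gram g f a b.
Proof. by rewrite star_sum; apply: eq_bigr => i _; rewrite starM starK. Qed.

Lemma gramDl f g h a b : gram (f + g) h a b = gram f h a b + gram g h a b.
Proof. by rewrite -gram_star gramDr starD !gram_star. Qed.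

Lemma gramZl (k : R[i]) f g a b : gram (k *: f) g a b = Num.conj k *: gram f g a b.
Proof. by rewrite -gram_star gramZr starZ gram_star. Qed.

Lemma gramNr f g a b : gram f (- g) a b = - gram f g a b.
Proof. by rewrite -scaleN1r gramZr scaleN1r. Qed.

Lemma gramNl f g a b : gram (- f) g a b = - gram f g a b.
Proof. by rewrite -gram_star gramNr starN gram_star. Qed.

Lemma gram_cat f g a b c :
  gram f g a (b + c) = gram f g a b + gram f g (a + b%:Z) c.
Proof.
rewrite /gram (big_cat_nat (leq0n b)) ?leq_addr //=; congr (_ + _).
rewrite -{1}[b]add0n big_addn addKn; apply: eq_bigr => i _.
by rewrite PoszD [i%:Z + _]addrC !addrA.
Qed.

Lemma gram_pos f a b : pos (gram f f a b).
Proof. by apply: pos_sum => i; exact: pos_starM. Qed.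

(** Extending a window on both sides adds positive terms. *)
Lemma cnorm_gram_mono f a b c d :
  cnorm (gram f f a b) <= cnorm (gram f f (a - c%:Z) (c + b + d)).
Proof.
apply: pos_cnorm_le; first exact: gram_pos.
rewrite !gram_cat PoszD addrA subrK [X in pos (X - _)]addrAC addrK.
by apply: posD; exact: gram_pos.
Qed.

Lemma wnorm_ge0 f a b : 0 <= wnorm f a b. Proof. exact: sqrtr_ge0. Qed.

Lemma wnorm_sqr f a b : wnorm f a b ^+ 2 = cnorm (gram f f a b).
Proof. by rewrite sqr_sqrtr ?cnorm_ge0. Qed.

Lemma cnorm_gram_le f g a b : cnorm (gram f g a b) <= wnorm f a b * wnorm g a b.
Proof.
rewrite -ler_sqr ?nnegrE ?mulr_ge0 ?cnorm_ge0 ?wnorm_ge0 // exprMn !wnorm_sqr.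
exact: cauchy_schwarz.
Qed.

Lemma wnormD f g a b : wnorm (f + g) a b <= wnorm f a b + wnorm g a b.
Proof.
rewrite -ler_sqr ?nnegrE ?addr_ge0 ?wnorm_ge0 // wnorm_sqr gramDl !gramDr.
apply: (le_trans (cnormD _ _)).
have := cnormD (gram f f a b) (gram f g a b).
have := cnormD (gram g f a b) (gram g g a b).
have := cnorm_gram_le f g a b; have := cnorm_gram_le g f a b.
rewrite -!wnorm_sqr; nra.
Qed.

Lemma wnormZ (k : R[i]) f a b :
  wnorm (k *: f) a b = normc k * wnorm f a b.
Proof.
have k0 := normc_ge0 k.
apply/eqP; rewrite -(@eqrXn2 _ 2) ?mulr_ge0 ?wnorm_ge0 //; apply/eqP.
rewrite exprMn !wnorm_sqr gramZr gramZl !cnormZ mulrA expr2; congr (_ * _ * _).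
by case: k {k0} => x y /=; rewrite sqrrN.
Qed.

Lemma wnorm0 a b : wnorm 0 a b = 0.
Proof. by rewrite -(scale0r 0) wnormZ Normc.normc0 mul0r. Qed.

Lemma wnorm_window1 f a : wnorm f a 1 = cnorm (f a).
Proof.
by rewrite /wnorm /gram big_nat1 addr0 cnorm_star sqrtr_sqr ger0_norm ?cnorm_ge0.
Qed.

Lemma wnorm_cat_le f a b : wnorm f a b.+1 <= wnorm f a b + cnorm (f (a + b%:Z)).
Proof.
rewrite -wnorm_window1 -ler_sqr ?nnegrE ?addr_ge0 ?wnorm_ge0 // wnorm_sqr.
rewrite -addn1 gram_cat; have := cnormD (gram f f a b) (gram f f (a + b%:Z) 1).
have := wnorm_ge0 f a b; have := wnorm_ge0 f (a + b%:Z) 1.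
rewrite -!wnorm_sqr; nra.
Qed.

Lemma wnorm_le_sum f a b : wnorm f a b <= \sum_(0 <= i < b) cnorm (f (a + i%:Z)).
Proof.
elim: b => [|b IH]; first by rewrite big_nil /wnorm /gram big_nil cnorm0 sqrtr0.
by rewrite big_nat_recr //=; apply: (le_trans (wnorm_cat_le _ _ _)); rewrite lerD2r.
Qed.

(* Convergence to [0] along windows [[a, a + b)] exhausting the integers. *)
Definition null (N : int -> nat -> A) : Prop :=
  forall e : R, 0 < e -> exists m : nat, forall a b,
    a <= - m%:Z -> m%:Z <= a + b%:Z -> cnorm (N a b) <= e.

Lemma eq_null (N M : int -> nat -> A) :
  (forall a b, M a b = N a b) -> null N -> null M.
Proof.
move=> NM N0 e e0; have [m hm] := N0 e e0.
by exists m => a b am mab; rewrite NM; exact: hm.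
Qed.

Lemma null0 (N : int -> nat -> A) : (forall a b, N a b = 0) -> null N.
Proof. by move=> N0 e e0; exists 0%N => a b _ _; rewrite N0 cnorm0 ltW. Qed.

Lemma nullD (N M : int -> nat -> A) :
  null N -> null M -> null (fun a b => N a b + M a b).
Proof.
move=> N0 M0 e e0; have e2 : 0 < e / 2 by rewrite divr_gt0.
have [m hm] := N0 _ e2; have [p hp] := M0 _ e2.
exists (maxn m p) => a b am mab; apply: (le_trans (cnormD _ _)).
have h1 : cnorm (N a b) <= e / 2 by apply: hm; lia.
have h2 : cnorm (M a b) <= e / 2 by apply: hp; lia.
by lra.
Qed.

Lemma nullZ (k : R[i]) (N : int -> nat -> A) :
  null N -> null (fun a b => k *: N a b).
Proof.
move=> N0 e e0; set c := normc k.
have c0 : 0 <= c := normc_ge0 k.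
have [|m hm] := N0 (e / (c + 1)); first by rewrite divr_gt0 // ltr_wpDl.
exists m => a b am mab; rewrite cnormZ -/c; have := hm a b am mab.
rewrite ler_pdivlMr ?ltr_wpDl //; have := cnorm_ge0 (N a b); nra.
Qed.

Lemma null_star (N : int -> nat -> A) : null N -> null (fun a b => star (N a b)).
Proof.
move=> N0 e e0; have [m hm] := N0 e e0.
by exists m => a b am mab; rewrite cnorm_starE; exact: hm.
Qed.

(** Turns an identity valid in the limit into a bound on every window: the window is enlarged, which
    cannot decrease its norm, until the error is at most [e]. *)
Lemma cnorm_gram_null f (N : int -> nat -> A) (C : R) :
  null (fun a b => gram f f a b - N a b) -> (forall a b, cnorm (N a b) <= C) ->
  forall a b, cnorm (gram f f a b) <= C.
Proof.
move=> fN NC a b; apply/ler_addgt0Pr => e e0; have [m hm] := fN e e0.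
(* This margin on each side carries the window past both [- m] and [m]. *)
pose c := (m + `|a|)%N.
apply: (le_trans (cnorm_gram_mono f a b c c)).
set a' := a - _; set b' := (_ + _)%N.
have h : cnorm (gram f f a' b' - N a' b') <= e by apply: hm; rewrite /a' /b' /c; lia.
have := cnormD (gram f f a' b' - N a' b') (N a' b'); rewrite subrK.
have := NC a' b'; lra.
Qed.

End Window.

(** * The complete module of functions on the integers *)

Section HilbertModule.
Variables (R : realType) (A : cstarAlgType R).

(* The Gram elements need not converge: bounded windows and decay at infinity suffice,
   because adjointness below only compares two pairings in the limit.  Decay makes the
   boundary terms of the shift vanish. *)
Definition hmem (f : int -> A) : Prop :=
  (exists C : R, forall a b, wnorm f a b <= C) /\
  (forall e : R, 0 < e ->
     exists m : nat, forall k : int, m%:Z <= `|k| -> cnorm (f k) <= e).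

Definition hpred : {pred (int -> A)} := [pred f | `[< hmem f >]].

Lemma hmem_lin (k : R[i]) f g : hmem f -> hmem g -> hmem (k *: f + g).
Proof.
move=> [[C fC] f0] [[D gD] g0]; set c := normc k.
have c0 : 0 <= c := normc_ge0 k.
split.
  exists (c * C + D) => a b; apply: (le_trans (wnormD _ _ _ _)).
  by rewrite wnormZ lerD // ler_wpM2l.
move=> e e0; have e2 : 0 < e / 2 by rewrite divr_gt0.
have [|m hm] := f0 (e / 2 / (c + 1)); first by rewrite divr_gt0 // ltr_wpDl.
have [p hp] := g0 _ e2; exists (maxn m p) => i hi.
have h1 : cnorm (f i) <= e / 2 / (c + 1) by apply: hm; lia.
have h2 : cnorm (g i) <= e / 2 by apply: hp; lia.
move: h1; rewrite ler_pdivlMr ?ltr_wpDl // => h1.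
have := cnormD (k *: f i) (g i); rewrite cnormZ -/c => h3.
apply: (le_trans h3); have := cnorm_ge0 (f i); nra.
Qed.

Lemma hmem0 : hmem 0.
Proof.
split; first by exists 0 => a b; rewrite wnorm0.
by move=> e e0; exists 0%N => k _; rewrite cnorm0 ltW.
Qed.

Lemma hpred_submod : submod_closed hpred.
Proof.
split; first by apply/asboolP; exact: hmem0.
by move=> k f g /asboolP fH /asboolP gH; apply/asboolP; exact: hmem_lin.
Qed.

HB.instance Definition _ := GRing.isSubmodClosed.Build R[i] (int -> A) hpred hpred_submod.

Record hilb := Hilb { hval :> int -> A ; _ : hval \in hpred }.

HB.instance Definition _ := [isSub for hval].
HB.instance Definition _ := [Choice of hilb by <:].
HB.instance Definition _ := [SubChoice_isSubLmodule of hilb by <:].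

Implicit Types x y : hilb.

Definition hilb_of (f : int -> A) (fH : hmem f) : hilb := Hilb (introT (asboolP _) fH).

Lemma hilbP x : hmem x. Proof. by case: x => f /= /asboolP. Qed.

Lemma hvalD x y : hval (x + y) = hval x + hval y. Proof. by []. Qed.
Lemma hvalZ (k : R[i]) x : hval (k *: x) = k *: hval x. Proof. by []. Qed.
Lemma hvalN x : hval (- x) = - hval x. Proof. by []. Qed.
Lemma hval0 : hval 0 = 0. Proof. by []. Qed.

Lemma hilb_ext x y : (forall k, x k = y k) -> x = y.
Proof. by move=> xy; apply/val_inj/funext. Qed.

Definition hnorm x : R := sup [set r | exists a b, r = wnorm x a b]%classic.

Lemma wnorm_le_hnorm x a b : wnorm x a b <= hnorm x.
Proof.
apply: ub_le_sup; last by exists a, b.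
by have [[C xC] _] := hilbP x; exists C => _ [c [d ->]].
Qed.

Lemma hnorm_le x (C : R) : (forall a b, wnorm x a b <= C) -> hnorm x <= C.
Proof.
move=> xC; apply: ge_sup; first by exists (wnorm x 0 0), 0, 0%N.
by move=> _ [a [b ->]].
Qed.

Lemma hnorm_ge0 x : 0 <= hnorm x.
Proof. exact: le_trans (wnorm_ge0 x 0 0) (wnorm_le_hnorm x 0 0). Qed.

Lemma cnorm_le_hnorm x k : cnorm (x k) <= hnorm x.
Proof. by rewrite -wnorm_window1 wnorm_le_hnorm. Qed.

Lemma hnorm_eq0 x : hnorm x = 0 -> x = 0.
Proof.
move=> x0; apply: hilb_ext => k; apply: cnorm_le0.
by rewrite -x0 cnorm_le_hnorm.
Qed.

Lemma hnormD x y : hnorm (x + y) <= hnorm x + hnorm y.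
Proof.
apply: hnorm_le => a b; apply: (le_trans (wnormD _ _ _ _)).
by rewrite lerD ?wnorm_le_hnorm.
Qed.

Lemma hnormZ_le (k : R[i]) x : hnorm (k *: x) <= normc k * hnorm x.
Proof.
by apply: hnorm_le => a b; rewrite wnormZ ler_wpM2l ?wnorm_le_hnorm ?normc_ge0.
Qed.

Lemma hnormN x : hnorm (- x) = hnorm x.
Proof.
have le z : hnorm (- z) <= hnorm z.
  rewrite -scaleN1r; apply: (le_trans (hnormZ_le _ _)).
  by rewrite normcN Normc.normc1 mul1r.
by apply/eqP; rewrite eq_le le -{1}[x]opprK le.
Qed.

Lemma hnorm0 : hnorm 0 = 0.
Proof.
by apply/eqP; rewrite eq_le hnorm_ge0 andbT; apply: hnorm_le => a b; rewrite wnorm0.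
Qed.

Lemma cnorm_gram_le_hnorm x y a b : cnorm (gram x y a b) <= hnorm x * hnorm y.
Proof.
apply: (le_trans (cnorm_gram_le _ _ _ _)).
by rewrite ler_pM ?wnorm_ge0 ?wnorm_le_hnorm.
Qed.

Lemma hnorm_sqr_le x (C : R) : 0 <= C ->
  (forall a b, cnorm (gram x x a b) <= C) -> hnorm x ^+ 2 <= C.
Proof.
move=> C0 xC; rewrite -(sqr_sqrtr C0) ler_sqr ?nnegrE ?hnorm_ge0 ?sqrtr_ge0 //.
by apply: hnorm_le => a b; apply: ler_wsqrtr.
Qed.

(** The limit is taken coordinate by coordinate; finite windows then transfer the Cauchy estimates
    to [hnorm]. *)
Lemma hnorm_limit (u : nat -> hilb) :
  (forall e : R, 0 < e ->
     exists N, forall m n, (N <= m)%N -> (N <= n)%N -> hnorm (u m - u n) <= e) ->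
  exists x, forall e N,
    (forall m n, (N <= m)%N -> (N <= n)%N -> hnorm (u m - u n) <= e) ->
    forall n, (N <= n)%N -> hnorm (u n - x) <= e.
Proof.
move=> uC.
have /boolp.choice[f uf] (k : int) : exists c, forall e N,
    (forall m n, (N <= m)%N -> (N <= n)%N -> cnorm (u m k - u n k) <= e) ->
    forall n, (N <= n)%N -> cnorm (u n k - c) <= e.
  apply: (@cnorm_limit R A (fun n => u n k)) => e /uC[N hN].
  exists N => m n Nm Nn.
  by apply: le_trans (hN _ _ Nm Nn); exact: (cnorm_le_hnorm (u m - u n)).
have ufh e N n k : (forall m n, (N <= m)%N -> (N <= n)%N -> hnorm (u m - u n) <= e) ->
    (N <= n)%N -> cnorm (u n k - f k) <= e.
  move=> hN; apply: uf => p q Np Nq; apply: le_trans (hN _ _ Np Nq).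
  exact: (cnorm_le_hnorm (u p - u q)).
(* [u n] is compared with a late [u p] in norm, and [u p] with [f] on the window, whose [b]
   coordinates contribute at most [e / (b + 1)] each. *)
have uw c N : (forall m n, (N <= m)%N -> (N <= n)%N -> hnorm (u m - u n) <= c) ->
    forall n, (N <= n)%N -> forall a b, wnorm (hval (u n) - f) a b <= c.
  move=> hN n Nn a b.
  apply/ler_addgt0Pr => e e0; have b1 : (0 : R) < b%:R + 1 by rewrite ltr_wpDl.
  have [|M hM] := uC (e / (b%:R + 1)); first by rewrite divr_gt0.
  set p := maxn n M.
  have -> : hval (u n) - f = (hval (u n) - hval (u p)) + (hval (u p) - f).
    by rewrite addrA subrK.
  apply: (le_trans (wnormD _ _ _ _)); apply: lerD.
    apply: (le_trans (wnorm_le_hnorm (u n - u p) a b)).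
    by apply: hN => //; exact: leq_trans Nn (leq_maxl _ _).
  apply: (le_trans (wnorm_le_sum _ _ _)).
  apply: (@le_trans _ _ (\sum_(0 <= i < b) (e / (b%:R + 1)))).
    by apply: ler_sum => i _; apply: ufh hM _; exact: leq_maxr.
  rewrite sumr_const_nat subn0.
  have : e / (b%:R + 1) * (b%:R + 1) = e by rewrite divfK ?gt_eqF.
  have : 0 <= e / (b%:R + 1) by rewrite divr_ge0 // ltW.
  by rewrite -[X in _ -> _ -> X <= _]mulr_natr; nra.
have fH : hmem f.
  split.
    have [//|N hN] := uC 1; exists (hnorm (u N) + 1) => a b.
    have -> : f = hval (u N) + (- 1) *: (hval (u N) - f).
      by rewrite scaleN1r opprB addrC subrK.
    apply: (le_trans (wnormD _ _ _ _)); rewrite lerD ?wnorm_le_hnorm //.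
    by rewrite wnormZ normcN Normc.normc1 mul1r; exact: uw hN _ _ _ _.
  move=> e e0; have e2 : 0 < e / 2 by rewrite divr_gt0.
  have [N hN] := uC _ e2; have [_ /(_ _ e2)[m hm]] := hilbP (u N).
  exists m => k km; have := hm k km; have := ufh _ _ N k hN (leqnn N).
  have := cnorm_triangle (u N k) (f k) 0; rewrite !subr0 (cnormBC (f k)); lra.
by exists (hilb_of fH) => e N hN n Nn; apply: hnorm_le => a b; exact: uw hN _ Nn _ _.
Qed.

End HilbertModule.

(** * The C*-algebra of adjointable operators *)

Section Adjoint.
Variables (R : realType) (A : cstarAlgType R).
Local Notation H := (hilb A).
Implicit Types (T S U : H -> H) (x y : H).

Definition adj T S : Prop :=
  forall x y, null (fun a b => gram (T x) y a b - gram x (S y) a b).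

Definition bounded_by T (C : R) : Prop := forall x, hnorm (T x) <= C * hnorm x.

Lemma adj_sym T S : adj T S -> adj S T.
Proof.
move=> h x y; apply: eq_null (nullZ (-1) (null_star (h y x))) => a b.
by rewrite starB !gram_star scaleN1r opprB.
Qed.

Lemma adj_id : adj id id.
Proof. by move=> x y; apply: null0 => a b; rewrite subrr. Qed.

Lemma adj_comp T T' S S' : adj T T' -> adj S S' -> adj (T \o S) (S' \o T').
Proof.
move=> hT hS x y; apply: eq_null (nullD (hT (S x) y) (hS x (T' y))) => a b /=.
by rewrite addrA subrK.
Qed.

Lemma adj_lin (k : R[i]) T T' S S' : adj T T' -> adj S S' ->
  adj (fun x => k *: T x + S x) (fun x => Num.conj k *: T' x + S' x).
Proof.
move=> hT hS x y.
apply: eq_null (nullD (nullZ (Num.conj k) (hT x y)) (hS x y)) => a b; cbv beta.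
by rewrite !hvalD !hvalZ gramDl gramDr gramZl gramZr opprD addrACA -scalerBr.
Qed.

(** Window norms only grow, so tending to 0 forces all of them to vanish. *)
Lemma gram_null_eq0 x y : null (gram (x - y) (x - y)) -> x = y.
Proof.
move=> h; apply/eqP; rewrite -subr_eq0; apply/eqP; apply: hnorm_eq0; apply/eqP.
rewrite -sqrf_eq0 eq_le sqr_ge0 andbT; apply: hnorm_sqr_le => // a b.
apply: (@cnorm_gram_null R A _ (fun _ _ => 0)); last by move=> *; rewrite cnorm0.
by apply: eq_null h => ? ?; rewrite subr0.
Qed.

Lemma adj_unique T S S' : adj T S -> adj T S' -> S = S'.
Proof.
move=> h h'; apply/funext => y; apply: gram_null_eq0.
set z := S y - S' y.
apply: eq_null (nullD (h' z y) (nullZ (-1) (h z y))) => a b.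
by rewrite {2}/z hvalD hvalN gramDr gramNr scaleN1r opprB [RHS]addrC addrA subrK.
Qed.

(** The adjoint forces linearity: [T (k *: x + y)] and [k *: T x + T y] have, in the limit, the same
    pairing with their difference [z]. *)
Lemma adj_linear T S : adj T S -> linear T.
Proof.
move=> h k x y; apply: gram_null_eq0; set z := T _ - _.
apply: eq_null (nullD (h (k *: x + y) z)
  (nullZ (-1) (nullD (nullZ (Num.conj k) (h x z)) (h y z)))) => a b.
rewrite {1}/z !hvalD !hvalN !hvalD !hvalZ !gramDl gramNl !gramDl !gramZl.
rewrite scaleN1r scalerBr addrACA -opprD opprB.
by rewrite addrA subrK opprD.
Qed.

(** In the limit [<S x, S x>] is [<T (S x), x>], of norm at most [C * |S x| * |x|]; one factor
    [|S x|] cancels. *)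
Lemma adj_bounded T S (C : R) : 0 <= C -> adj T S -> bounded_by T C -> bounded_by S C.
Proof.
move=> C0 h TC x.
have [->|n0] := eqVneq (hnorm (S x)) 0; first by rewrite mulr_ge0 ?hnorm_ge0.
have p0 : 0 < hnorm (S x) by rewrite lt_def n0 hnorm_ge0.
rewrite -(ler_pM2r p0) -expr2; apply: hnorm_sqr_le.
  by rewrite !mulr_ge0 ?hnorm_ge0.
apply: (@cnorm_gram_null R A _ (gram (T (S x)) x)) => [|a b].
  apply: eq_null (nullZ (-1) (h (S x) x)) => a b.
  by rewrite scaleN1r opprB.
apply: (le_trans (cnorm_gram_le_hnorm _ _ _ _)).
by rewrite mulrAC ler_wpM2r ?hnorm_ge0.
Qed.

Definition opred : {pred (H -> H)} :=
  [pred T | `[< (exists S, adj T S) /\ exists C, 0 <= C /\ bounded_by T C >]].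

Lemma opredP T : reflect ((exists S, adj T S) /\ exists C, 0 <= C /\ bounded_by T C)
  (T \in opred).
Proof. exact: asboolP. Qed.

Lemma opred_submod : submod_closed opred.
Proof.
split.
  apply/opredP; split.
    exists (fun _ => 0) => x y; apply: null0 => a b.
    by rewrite !hval0 -(scale0r 0) gramZl gramZr !(scale0r, conjC0) subrr.
  by exists 0; split=> // x; rewrite mul0r hnorm0.
move=> k T S /opredP[[T' hT] [C [C0 TC]]] /opredP[[S' hS] [D [D0 SD]]].
apply/opredP; split; first by eexists; exact: adj_lin hT hS.
have k0 := normc_ge0 k.
exists (normc k * C + D); split; first by rewrite addr_ge0 ?mulr_ge0.
move=> x; apply: le_trans (hnormD (k *: T x) (S x)) _; rewrite mulrDl lerD //.
by apply: (le_trans (hnormZ_le _ _)); rewrite -mulrA ler_wpM2l.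
Qed.

HB.instance Definition _ := GRing.isSubmodClosed.Build R[i] (H -> H) opred opred_submod.

Record op := Op { oval :> H -> H ; _ : oval \in opred }.

HB.instance Definition _ := [isSub for oval].
HB.instance Definition _ := [Choice of op by <:].
HB.instance Definition _ := [SubChoice_isSubLmodule of op by <:].

Lemma op_ext (T S : op) : (forall x, T x = S x) -> T = S.
Proof. by move=> h; apply/val_inj/funext. Qed.

Lemma ovalZ (k : R[i]) (T : op) x : (k *: T) x = k *: T x. Proof. by []. Qed.
Lemma op_adj (T : op) : exists S, adj T S.
Proof. by case: T => T /= /opredP[]. Qed.

Lemma op_bounded (T : op) : exists C, 0 <= C /\ bounded_by T C.
Proof. by case: T => T /= /opredP[]. Qed.

Lemma op_linear (T : op) : linear T.
Proof. by have [S /adj_linear] := op_adj T. Qed.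

Lemma op_id_subproof : id \in opred.
Proof.
apply/opredP; split; first by exists id; exact: adj_id.
by exists 1; split=> // x; rewrite mul1r.
Qed.
Definition op1 : op := Op op_id_subproof.

Lemma op_mul_subproof (T S : op) : oval T \o oval S \in opred.
Proof.
have [T' hT] := op_adj T; have [S' hS] := op_adj S.
apply/opredP; split; first by eexists; exact: adj_comp hT hS.
have [C [C0 TC]] := op_bounded T; have [D [D0 SD]] := op_bounded S.
exists (C * D); split; first exact: mulr_ge0.
by move=> x; apply: (le_trans (TC _)); rewrite -mulrA ler_wpM2l.
Qed.
Definition op_mul (T S : op) : op := Op (op_mul_subproof T S).

Lemma op_mulA : associative op_mul. Proof. by move=> T S U; exact: op_ext. Qed.
Lemma op_mul1 : left_id op1 op_mul. Proof. by move=> T; exact: op_ext. Qed.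
Lemma op_mulr1 : right_id op1 op_mul. Proof. by move=> T; exact: op_ext. Qed.
Lemma op_mulDl : left_distributive op_mul +%R.
Proof. by move=> T S U; exact: op_ext. Qed.
Lemma op_mulDr : right_distributive op_mul +%R.
Proof.
move=> T S U; apply: op_ext => x.
by rewrite -[LHS]/(T (S x + U x)) -[S x]scale1r op_linear !scale1r.
Qed.

Definition delta_fun (k : int) (c : A) : int -> A := fun j => if j == k then c else 0.

Lemma delta_wnorm k c a b : wnorm (delta_fun k c) a b <= cnorm c.
Proof.
apply: (le_trans (wnorm_le_sum _ _ _)).
suff -> : \sum_(0 <= i < b) cnorm (delta_fun k c (a + i%:Z)) =
    if (a <= k) && (k < a + b%:Z) then cnorm c else 0.
  by case: ifP; rewrite ?cnorm_ge0.
elim: b => [|b IH]; first by rewrite big_nil ifF //; lia.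
rewrite big_nat_recr //= IH /delta_fun; case: eqVneq => h.
  by rewrite ifF ?ifT ?add0r //; lia.
by rewrite cnorm0 addr0; congr (if _ then _ else _); lia.
Qed.

Lemma delta_hmem k c : hmem (delta_fun k c).
Proof.
split; first by exists (cnorm c) => a b; exact: delta_wnorm.
move=> e e0; exists (`|k|.+1)%N => j hj.
by rewrite /delta_fun ifF ?cnorm0 ?ltW //; lia.
Qed.

Definition delta k c : H := hilb_of (delta_hmem k c).

Lemma deltaE k c : delta k c k = c.
Proof. by rewrite /= /delta_fun eqxx. Qed.

Lemma op1_neq0 : op1 != 0.
Proof.
apply/eqP => /(congr1 (fun T : op => T (delta 0 1) 0)).
by rewrite [LHS]deltaE => /eqP; rewrite oner_eq0.
Qed.

HB.instance Definition _ := GRing.Zmodule_isNzRing.Build op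
  op_mulA op_mul1 op_mulr1 op_mulDl op_mulDr op1_neq0.

Lemma ovalM (T S : op) x : (T * S) x = T (S x). Proof. by []. Qed.

Lemma op_scaleAl (k : R[i]) (T S : op) : k *: (T * S) = (k *: T) * S.
Proof. exact: op_ext. Qed.
HB.instance Definition _ := GRing.Lmodule_isLalgebra.Build R[i] op op_scaleAl.

Lemma opZ (T : op) (k : R[i]) x : T (k *: x) = k *: T x.
Proof.
have := op_linear T k x 0; have -> : T 0 = 0; last by rewrite !addr0.
have := op_linear T 1 0 0; rewrite !scale1r addr0 => /eqP.
by rewrite -subr_eq subrr eq_sym => /eqP.
Qed.

Lemma op_scaleAr (k : R[i]) (T S : op) : k *: (T * S) = T * (k *: S).
Proof. by apply: op_ext => x; rewrite ovalZ !ovalM ovalZ opZ. Qed.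
HB.instance Definition _ := GRing.Lalgebra_isAlgebra.Build R[i] op op_scaleAr.

(** At [x = 0] the quotient is [0 / 0 = 0], harmless in a supremum of nonnegative quotients. *)
Definition opnorm (T : op) : R :=
  sup [set r | exists x, r = hnorm (T x) / hnorm x]%classic.

Lemma opnorm_le (T : op) (C : R) : 0 <= C -> bounded_by T C -> opnorm T <= C.
Proof.
move=> C0 TC; apply: ge_sup; first by exists (hnorm (T 0) / hnorm (0 : H)), 0.
move=> _ [x ->]; have [->|x0] := eqVneq (hnorm x) 0; first by rewrite invr0 mulr0.
by rewrite ler_pdivrMr // lt_def x0 hnorm_ge0.
Qed.

Lemma le_opnorm (T : op) : bounded_by T (opnorm T).
Proof.
move=> x; have [C [C0 TC]] := op_bounded T.
have [h|x0] := eqVneq (hnorm x) 0.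
  by have := TC x; rewrite h !mulr0.
have xp : 0 < hnorm x by rewrite lt_def x0 hnorm_ge0.
rewrite -ler_pdivrMr //; apply: ub_le_sup; last by exists x.
exists C => _ [y ->]; have [->|y0] := eqVneq (hnorm y) 0; first by rewrite invr0 mulr0.
by rewrite ler_pdivrMr // lt_def y0 hnorm_ge0.
Qed.

Lemma opnorm_ge0 (T : op) : 0 <= opnorm T.
Proof.
have := le_opnorm T (delta 0 1); have := hnorm_ge0 (T (delta 0 1)).
have : 0 < hnorm (delta 0 1).
  by apply: lt_le_trans (cnorm_le_hnorm (delta 0 1) 0); rewrite deltaE cnorm1.
nra.
Qed.

Lemma opnorm_eq0 (T : op) : opnorm T = 0 -> T = 0.
Proof.
move=> T0; apply: op_ext => x; apply: hnorm_eq0; apply/eqP.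
by rewrite eq_le hnorm_ge0 andbT; have := le_opnorm T x; rewrite T0 mul0r.
Qed.

Lemma opnormD (T S : op) : opnorm (T + S) <= opnorm T + opnorm S.
Proof.
apply: opnorm_le => [|x]; first by rewrite addr_ge0 ?opnorm_ge0.
by apply: (le_trans (hnormD _ _)); rewrite mulrDl lerD ?le_opnorm.
Qed.

Lemma opnormZ (k : R[i]) (T : op) :
  opnorm (k *: T) = normc k * opnorm T.
Proof.
have n0 (c : R[i]) := normc_ge0 c.
have le c (S : op) : opnorm (c *: S) <= normc c * opnorm S.
  apply: opnorm_le => [|x]; first by rewrite mulr_ge0 ?opnorm_ge0.
  by apply: (le_trans (hnormZ_le _ _)); rewrite -mulrA ler_wpM2l ?le_opnorm.
have [->|k0] := eqVneq k 0.
  rewrite Normc.normc0 mul0r; apply/eqP; rewrite eq_le opnorm_ge0 andbT.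
  by apply: (le_trans (le _ _)); rewrite Normc.normc0 mul0r.
apply/eqP; rewrite eq_le le /=.
have kp : 0 < normc k.
  rewrite lt_def n0 andbT; apply: contra k0 => /eqP h.
  by apply/eqP; exact: Normc.eq0_normc.
rewrite -ler_pdivlMl // -Normc.normcV.
rewrite -[T in opnorm T <= _]scale1r -(mulVf k0) -scalerA.
exact: le.
Qed.

Lemma opnormM (T S : op) : opnorm (T * S) <= opnorm T * opnorm S.
Proof.
apply: opnorm_le => [|x]; first by rewrite mulr_ge0 ?opnorm_ge0.
apply: (le_trans (le_opnorm T (S x))).
by rewrite -mulrA ler_wpM2l ?opnorm_ge0 ?le_opnorm.
Qed.

Definition op_star_fun (T : op) : H -> H := projT1 (cid (op_adj T)).

Lemma op_star_funP (T : op) : adj T (op_star_fun T).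
Proof. by rewrite /op_star_fun; case: cid. Qed.

Lemma op_star_subproof (T : op) : op_star_fun T \in opred.
Proof.
apply/opredP; split; first by exists T; exact/adj_sym/op_star_funP.
exists (opnorm T); split; first exact: opnorm_ge0.
exact: adj_bounded (opnorm_ge0 T) (op_star_funP T) (le_opnorm T).
Qed.

Definition op_star (T : op) : op := Op (op_star_subproof T).

Lemma op_starP (T : op) : adj T (op_star T).
Proof. exact: op_star_funP. Qed.

Lemma op_star_eq (T S : op) : adj T S -> op_star T = S.
Proof. by move=> h; apply/val_inj/(adj_unique (op_starP T)). Qed.

Lemma op_starK : involutive op_star.
Proof. by move=> T; apply/op_star_eq/adj_sym/op_starP. Qed.

Lemma op_starM (T S : op) : op_star (T * S) = op_star S * op_star T.
Proof. exact/op_star_eq/(adj_comp (op_starP T) (op_starP S)). Qed.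

Lemma op_starD : {morph op_star : T S / T + S}.
Proof.
move=> T S; apply: op_star_eq => x y.
have := adj_lin 1 (op_starP T) (op_starP S) x y.
by rewrite conjC1 !scale1r.
Qed.

Lemma op_star0 : op_star 0 = 0.
Proof. by apply: (addrI (op_star 0)); rewrite -op_starD !addr0. Qed.

Lemma op_starB (T S : op) : op_star (T - S) = op_star T - op_star S.
Proof. by apply/eqP; rewrite eq_sym subr_eq -op_starD subrK. Qed.

Lemma op_starZ (k : R[i]) (T : op) : op_star (k *: T) = Num.conj k *: op_star T.
Proof.
apply: op_star_eq => x y.
have := adj_lin k (op_starP T) (op_starP 0) x y.
by rewrite op_star0 !addr0.
Qed.

Lemma opnorm_starE (T : op) : opnorm (op_star T) = opnorm T.
Proof.
have le (S : op) : opnorm (op_star S) <= opnorm S.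
  apply: opnorm_le (opnorm_ge0 S) _.
  exact: adj_bounded (opnorm_ge0 S) (op_starP S) (le_opnorm S).
by apply/eqP; rewrite eq_le le -{1}[T]op_starK le.
Qed.

(** For the harder inequality, [<T x, T x>] agrees in the limit with [<x, op_star T (T x)>], of norm
    at most [opnorm (op_star T * T) * |x| ^ 2]. *)
Lemma opnorm_star (T : op) : opnorm (op_star T * T) = opnorm T ^+ 2.
Proof.
apply/eqP; rewrite eq_le; apply/andP; split.
  by apply: (le_trans (opnormM _ _)); rewrite opnorm_starE expr2.
have t0 := opnorm_ge0 (op_star T * T).
rewrite -(sqr_sqrtr t0) ler_sqr ?nnegrE ?opnorm_ge0 ?sqrtr_ge0 //.
apply: opnorm_le (sqrtr_ge0 _) _ => x.
rewrite -ler_sqr ?nnegrE ?mulr_ge0 ?hnorm_ge0 ?sqrtr_ge0 // exprMn sqr_sqrtr //.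
apply: hnorm_sqr_le; first by rewrite mulr_ge0 ?sqr_ge0.
apply: cnorm_gram_null (op_starP T x (T x)) _ => a b.
apply: (le_trans (cnorm_gram_le_hnorm _ _ _ _)).
rewrite mulrC expr2 mulrA ler_wpM2r ?hnorm_ge0 //.
exact: (le_opnorm (op_star T * T)).
Qed.

(** Pointwise limits exist for the sequence and for its adjoints; the second limit is an adjoint of
    the first, which keeps the limit inside [op]. *)
Lemma op_limit (u : nat -> op) :
  (forall e : R, 0 < e ->
     exists N, forall m n, (N <= m)%N -> (N <= n)%N -> opnorm (u m - u n) <= e) ->
  exists T : op, forall e N, 0 <= e ->
    (forall m n, (N <= m)%N -> (N <= n)%N -> opnorm (u m - u n) <= e) ->
    forall n, (N <= n)%N -> opnorm (u n - T) <= e.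
Proof.
have ptwise (v : nat -> op) : (forall e : R, 0 < e ->
     exists N, forall m n, (N <= m)%N -> (N <= n)%N -> opnorm (v m - v n) <= e) ->
   exists T : H -> H, forall e N,
    (forall m n, (N <= m)%N -> (N <= n)%N -> opnorm (v m - v n) <= e) ->
    forall n, (N <= n)%N -> forall x, hnorm (v n x - T x) <= e * hnorm x.
  move=> vC; suff /boolp.choice[T hT] (x : H) : exists y, forall e N,
      (forall m n, (N <= m)%N -> (N <= n)%N -> opnorm (v m - v n) <= e) ->
      forall n, (N <= n)%N -> hnorm (v n x - y) <= e * hnorm x.
    by exists T => e N hN n Nn x; exact: hT hN n Nn.
  have vx e m n : opnorm (v m - v n) <= e -> hnorm (v m x - v n x) <= e * hnorm x.
    move=> h; apply: (le_trans (le_opnorm (v m - v n) x)).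
    by rewrite ler_wpM2r ?hnorm_ge0.
  have [|y hy] := @hnorm_limit R A (fun n => v n x).
    move=> e e0; have x1 : 0 < hnorm x + 1 by rewrite ltr_wpDl ?hnorm_ge0.
    have [|N hN] := vC (e / (hnorm x + 1)); first by rewrite divr_gt0.
    exists N => m n Nm Nn; apply: (le_trans (vx _ _ _ (hN m n Nm Nn))).
    by rewrite mulrAC ler_pdivrMr // ler_pM2l //; lra.
  by exists y => e N hN n Nn; apply: hy Nn => p q Np Nq; apply: vx; exact: hN.
move=> uC; have [T hT] := ptwise u uC.
have [|S hS] := ptwise (fun n => op_star (u n)).
  by move=> e /uC[N hN]; exists N => m n Nm Nn; rewrite -op_starB opnorm_starE hN.
have TS : adj T S.
  move=> x y e e0; have p0 : 0 < hnorm x * hnorm y + 1.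
    by rewrite ltr_wpDl ?mulr_ge0 ?hnorm_ge0.
  have e3 : 0 < e / 3 by rewrite divr_gt0.
  have [|N hN] := uC (e / 3 / (hnorm x * hnorm y + 1)); first by rewrite divr_gt0.
  have hp := hT _ _ hN _ (leqnn N) x.
  have hq : hnorm (op_star (u N) y - S y) <= e / 3 / (hnorm x * hnorm y + 1) * hnorm y.
    apply: (hS _ N _ N (leqnn N) y) => m n Nm Nn.
    by rewrite -op_starB opnorm_starE hN.
  have [m hm] := op_starP (u N) x y e3.
  exists m => a b am mab; have h1 := hm a b am mab.
  set P := u N x - T x in hp; set Q := op_star (u N) y - S y in hq.
  (* One third of [e] bounds the pairing error of [u N], and one third each of the terms in [P] and
     [Q]. *)
  have -> : gram (T x) y a b - gram x (S y) a b =
      gram (u N x) y a b - gram x (op_star (u N) y) a b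
      + (gram x Q a b - gram P y a b).
    rewrite /P /Q !hvalD !hvalN gramDr gramDl gramNl gramNr opprB.
    by rewrite [RHS](AC (2*(2*2)) ((5*4)*((1*6)*(2*3)))) /= subrr addNr !addr0.
  have h2 : e / 3 / (hnorm x * hnorm y + 1) * hnorm x * hnorm y <= e / 3.
    rewrite -mulrA mulrAC ler_pdivrMr // ler_pM2l //; lra.
  have h3 := cnorm_gram_le_hnorm x Q a b.
  have h4 := cnorm_gram_le_hnorm P y a b.
  have h5 : hnorm x * hnorm Q <= e / 3.
    by apply: le_trans h2; rewrite -mulrA mulrCA ler_wpM2l ?hnorm_ge0.
  have h6 : hnorm P * hnorm y <= e / 3.
    by apply: le_trans h2; rewrite ler_wpM2r ?hnorm_ge0.
  have h7 := cnormB (gram x Q a b) (gram P y a b).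
  by apply: (le_trans (cnormD _ _)); lra.
have Top : T \in opred.
  apply/opredP; split; first by exists S.
  have [//|N hN] := uC 1; exists (opnorm (u N) + 1); split.
    by rewrite addr_ge0 ?opnorm_ge0.
  move=> x; have := hT _ _ hN _ (leqnn N) x.
  have := hnormD (u N x) (- (u N x - T x)).
  rewrite opprB addrC subrK -[X in hnorm X <= _ * _]opprB hnormN mulrDl.
  have := le_opnorm (u N) x; lra.
exists (Op Top) => e N e0 hN n Nn; apply: opnorm_le => // x.
exact: hT hN n Nn x.
Qed.

Lemma op_complete (u : op ^nat) :
  (forall e : R, 0 < e ->
    \forall m \near \oo & p \near \oo, opnorm (u m - u p) < e)%classic ->
  exists T : op, (opnorm (u m - T) @[m --> \oo] --> (0 : R))%classic.
Proof.
move=> uC; have uN e : 0 < e ->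
    exists N, forall m n, (N <= m)%N -> (N <= n)%N -> opnorm (u m - u n) <= e.
  move=> /uC[[P Q] [[N _ hN] [M _ hM]] PQ]; exists (maxn N M) => m n Nm Nn.
  apply/ltW/(PQ (m, n)); split.
    by apply: hN; apply: leq_trans Nm; exact: leq_maxl.
  by apply: hM; apply: leq_trans Nn; exact: leq_maxr.
have [T hT] := op_limit uN; exists T; apply/cvgrPdist_le => e e0.
have [N hN] := uN e e0; exists N => // n /(hT e N (ltW e0) hN) h.
by rewrite sub0r normrN ger0_norm ?opnorm_ge0.
Qed.

HB.instance Definition _ := isCstarAlgebra.Build R op opnorm_eq0 opnormD opnormZ
  opnormM op_complete op_starK op_starD op_starZ op_starM opnorm_star.

End Adjoint.

(** * Adjoining a unitary *)

Section DiagonalShift.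
Variables (R : realType) (B : cstarAlgType R).
Local Notation H := (hilb B).

(** The Gram elements differ by a sum of conjugates by [f k] of [C ^ 2 - star (d k) * d k], positive
    because [|d k| <= C]. *)
Lemma wnorm_diag (d : int -> B) (C : R) (f : int -> B) a b :
  0 <= C -> (forall k, cnorm (d k) <= C) ->
  wnorm (fun k => d k * f k) a b <= C * wnorm f a b.
Proof.
move=> C0 dC; rewrite -ler_sqr ?nnegrE ?mulr_ge0 ?wnorm_ge0 // exprMn !wnorm_sqr.
have -> : C ^+ 2 * cnorm (gram f f a b) = cnorm (C ^+ 2 *r gram f f a b).
  by rewrite cnormZr ger0_norm ?sqr_ge0.
apply: pos_cnorm_le; first exact: gram_pos.
rewrite /gram scaler_sumr -sumrB; apply: pos_sum => i.
set k := a + _; rewrite starM.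
have -> : C ^+ 2 *r (star (f k) * f k) - star (f k) * star (d k) * (d k * f k) =
    star (f k) * (C ^+ 2 *r 1 - star (d k) * d k) * f k.
  by rewrite mulrBr mulrBl -scalerAr mulr1 -scalerAl !mulrA.
apply/pos_conj/pos_scale_sub; first exact: pos_starM.
by rewrite cnorm_star ler_sqr ?nnegrE ?cnorm_ge0.
Qed.

Lemma diag_hmem (d : int -> B) (C : R) (x : H) :
  0 <= C -> (forall k, cnorm (d k) <= C) -> hmem (fun k => d k * x k).
Proof.
move=> C0 dC; have [_ x0] := hilbP x; split.
  exists (C * hnorm x) => a b; apply: (le_trans (wnorm_diag _ _ _ C0 dC)).
  by rewrite ler_wpM2l ?wnorm_le_hnorm.
move=> e e0; have [|m hm] := x0 (e / (C + 1)); first by rewrite divr_gt0 // ltr_wpDl.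
exists m => k /hm; rewrite ler_pdivlMr ?ltr_wpDl // => h.
apply: (le_trans (cnormM _ _)).
have := dC k; have := cnorm_ge0 (x k); nra.
Qed.

Lemma diag_op (d : int -> B) (C : R) : (forall k, cnorm (d k) <= C) ->
  exists T : op B, forall x k, T x k = d k * x k /\ star T x k = star (d k) * x k.
Proof.
move=> dC; have C0 : 0 <= C := le_trans (cnorm_ge0 (d 0)) (dC 0).
have dC' k : cnorm (star (d k)) <= C by rewrite cnorm_starE.
pose T (x : H) : H := hilb_of (diag_hmem x C0 dC).
pose S (x : H) : H := hilb_of (diag_hmem x C0 dC').
have TS : adj T S.
  move=> x y; apply: null0 => a b; apply/eqP; rewrite subr_eq0; apply/eqP.
  by apply: eq_bigr => i _ /=; rewrite starM mulrA.
have Top : T \in @opred R B.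
  apply/opredP; split; first by exists S.
  exists C; split=> // x; apply: hnorm_le => a b.
  apply: (le_trans (wnorm_diag _ _ _ C0 dC)).
  by rewrite ler_wpM2l ?wnorm_le_hnorm.
exists (Op Top) => x k; split=> //.
have -> : star (Op Top) x = S x; last by [].
exact: (congr1 (fun F => F x) (adj_unique (op_starP (Op Top)) TS)).
Qed.

Definition shift_fun (c : int) (f : int -> B) : int -> B := fun k => f (k + c).

Lemma shift_wnorm c f a b : wnorm (shift_fun c f) a b = wnorm f (a + c) b.
Proof.
rewrite /wnorm /gram; congr (Num.sqrt (cnorm _)); apply: eq_bigr => i _.
by rewrite /shift_fun addrAC.
Qed.

Lemma shift_hmem c (x : H) : hmem (shift_fun c x).
Proof.
have [_ x0] := hilbP x; split.
  by exists (hnorm x) => a b; rewrite shift_wnorm wnorm_le_hnorm.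
move=> e /x0[m hm]; exists (m + `|c|)%N => k hk; apply: hm; lia.
Qed.

(** Both sides are the pairing on the window of length [b + 1], split at its last or at its first
    term; the shift and its inverse are thus adjoint up to boundary terms. *)
Lemma shift_gram f g a b :
  gram (shift_fun (- 1) f) g a b + star (f (a + b%:Z - 1)) * g (a + b%:Z) =
  star (f (a - 1)) * g a + gram f (shift_fun 1 g) a b.
Proof.
have one F G c : gram F G c 1 = star (F c) * G c by rewrite /gram big_nat1 addr0.
have := gram_cat (shift_fun (- 1) f) g a b 1; rewrite one => <-.
rewrite addnC gram_cat one; congr (_ + _); apply: eq_bigr => i _.
by rewrite /shift_fun addrAC addrK addrAC.
Qed.

Lemma shift_op : exists W : op B, forall x k, W x k = x (k - 1) /\ star W x k = x (k + 1).
Proof.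
pose W (x : H) : H := hilb_of (shift_hmem (- 1) x).
pose V (x : H) : H := hilb_of (shift_hmem 1 x).
have WV : adj W V.
  move=> x y e e0; have y1 : 0 < hnorm y + 1 by rewrite ltr_wpDl ?hnorm_ge0.
  have [_ x0] := hilbP x; have [|m hm] := x0 (e / 2 / (hnorm y + 1)).
    by rewrite !divr_gt0.
  have small k : m%:Z <= `|k - 1| -> cnorm (star (x (k - 1)) * y k) <= e / 2.
    move=> /hm; rewrite ler_pdivlMr // => h.
    apply: (le_trans (cnormM _ _)); rewrite cnorm_starE.
    have := cnorm_le_hnorm y k; have := cnorm_ge0 (x (k - 1)); nra.
  (* The boundary terms involve [x] at [a - 1] and [a + b - 1]; the successor keeps the second index
     at distance at least [m] from 0. *)
  exists m.+1 => a b am mab.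
  have -> : gram (W x) y a b - gram x (V y) a b =
      star (x (a - 1)) * y a - star (x (a + b%:Z - 1)) * y (a + b%:Z).
    by apply/eqP; rewrite subr_eq addrAC -shift_gram addrK.
  apply: (le_trans (cnormB _ _)).
  have h1 : cnorm (star (x (a - 1)) * y a) <= e / 2 by apply: small; lia.
  have h2 : cnorm (star (x (a + b%:Z - 1)) * y (a + b%:Z)) <= e / 2.
    by apply: small; lia.
  by lra.
have Wop : W \in @opred R B.
  apply/opredP; split; first by exists V.
  exists 1; split=> // x; rewrite mul1r; apply: hnorm_le => a b.
  by rewrite shift_wnorm wnorm_le_hnorm.
exists (Op Wop) => x k; split=> //.
have -> : star (Op Wop) x = V x; last by [].
exact: (congr1 (fun F => F x) (adj_unique (op_starP (Op Wop)) WV)).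
Qed.

End DiagonalShift.

(** * Relations between twisted diagonals and the bilateral shift *)

Section Twist.
Variables (R : realType) (B : cstarAlgType R).
Implicit Types (c q : R[i]) (s t : B) (S T W : op B).

Lemma norm_expz_unit c (k : int) : `|c| = 1 -> `|c ^ k| = 1.
Proof.
move=> c1; case: k => n; first by rewrite -exprnP normrX c1 expr1n.
by rewrite NegzE -exprnN normfV normrX c1 expr1n invr1.
Qed.

Lemma expz_succ c (k : int) : `|c| = 1 -> c * c ^ k = c ^ (k + 1).
Proof.
move=> c1; rewrite exprzDr ?expr1z 1?mulrC // unitfE -normr_eq0 c1.
exact: oner_neq0.
Qed.

(** The adjoint is specified together with [T], so that relations can be checked one coordinate at a
    time. *)
Definition twisted_diagonal c s T : Prop := forall x k,
  T x k = c ^ k *: (s * x k) /\ star T x k = Num.conj (c ^ k) *: (star s * x k).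

Definition bilateral_shift W : Prop := forall x k,
  W x k = x (k - 1) /\ star W x k = x (k + 1).

Lemma twisted_diagonal_exists c s : `|c| = 1 -> exists T, twisted_diagonal c s T.
Proof.
move=> c1; have [|T hT] := @diag_op R B (fun k => c ^ k *: s) (cnorm s).
  by move=> k; rewrite cnormZ normc_unit ?mul1r // norm_expz_unit.
by exists T => x k; have [-> ->] := hT x k; rewrite starZ -!scalerAl.
Qed.

Lemma twisted_diagonal_isometry c s T : `|c| = 1 ->
  twisted_diagonal c s T -> isometry s -> isometry T.
Proof.
move=> c1 hT ss; apply: op_ext => x; apply: hilb_ext => k.
rewrite ovalM (hT _ k).2 (hT _ k).1 -scalerAr scalerA mulrC -normCK.
by rewrite norm_expz_unit // expr1n scale1r mulrA ss mul1r.
Qed.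

Lemma twisted_diagonal_unitary c s T : `|c| = 1 ->
  twisted_diagonal c s T -> unitary s -> unitary T.
Proof.
move=> c1 hT [ss' s's]; split; first exact: twisted_diagonal_isometry hT _.
apply: op_ext => x; apply: hilb_ext => k.
rewrite ovalM (hT _ k).1 (hT _ k).2 -scalerAr scalerA -normCK.
by rewrite norm_expz_unit // expr1n scale1r mulrA s's mul1r.
Qed.

(** At coordinate [k] the scalars coming from [b ^ k] and [c ^ k] factor out of both sides, so the
    old relations survive the twist. *)
Lemma twisted_diagonal_comm b c q s t S T :
  twisted_diagonal b s S -> twisted_diagonal c t T ->
  star s * t = q *: (t * star s) -> star S * T = q *: (T * star S).
Proof.
move=> hS hT st; apply: op_ext => x; apply: hilb_ext => k.
rewrite ovalZ !ovalM hvalZ (hS _ k).2 (hT _ k).1 -[RHS]/(q *: T (star S x) k).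
rewrite (hT _ k).1 (hS _ k).2 -!scalerAr !scalerA mulrA st -scalerAl scalerA.
by rewrite mulrA; congr (_ *: _); ring.
Qed.

Lemma bilateral_shift_unitary W : bilateral_shift W -> unitary W.
Proof.
move=> hW; split; apply: op_ext => x; apply: hilb_ext => k; rewrite ovalM.
  by rewrite (hW _ k).2 (hW _ _).1 addrK.
by rewrite (hW _ k).1 (hW _ _).2 subrK.
Qed.

(** [star W] reads coordinate [k + 1], where the diagonal carries one more factor [c] than at [k];
    this factor is the new commutation constant. *)
Lemma star_shift_twisted_diagonal c s W T : `|c| = 1 ->
  bilateral_shift W -> twisted_diagonal c s T ->
  star W * T = c *: (T * star W).
Proof.
move=> c1 hW hT; apply: op_ext => x; apply: hilb_ext => k.
rewrite ovalZ !ovalM -[RHS]/(c *: T (star W x) k) (hW _ k).2 !(hT _ _).1 (hW _ k).2.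
by rewrite scalerA expz_succ.
Qed.

Lemma star_twisted_diagonal_shift c s W T : `|c| = 1 ->
  bilateral_shift W -> twisted_diagonal c s T ->
  star T * W = Num.conj c *: (W * star T).
Proof.
move=> c1 hW hT; apply: op_ext => x; apply: hilb_ext => k.
rewrite ovalZ !ovalM -[RHS]/(Num.conj c *: W (star T x) k) (hW _ k).1 !(hT _ _).2.
by rewrite (hW _ k).1 scalerA -rmorphM expz_succ // subrK.
Qed.

End Twist.

(** * The coefficient at 0 and injectivity *)

Section CompressionInjective.
Variables (R : realType) (A B : cstarAlgType R) (n : nat) (s : 'I_n -> A).
Variables (phi : A -> B) (Phi : A -> op B) (c : 'I_n -> R[i]).
Hypothesis s_gen : generates s.
Hypothesis phiH : unital_star_hom phi.
Hypothesis PhiH : unital_star_hom Phi.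
Hypothesis Phi_s : forall i, twisted_diagonal (c i) (phi (s i)) (Phi (s i)).

(* The [0]-th coefficient does not see the twist, since [c ^ 0 = 1]. *)
Lemma coefficient0_hom a (x : hilb B) : Phi a x 0 = phi a * x 0.
Proof.
(* [P] ranges over all [x] to be stable under products, where [Phi d x] takes the place of [x];
   joining [P (star a)] to it gives stability under the involution. *)
pose P a := forall x : hilb B, Phi a x 0 = phi a * x 0.
suff : a \in [pred a | `[< P a /\ P (star a) >]] by move=> /asboolP[h _]; exact: h.
have Plin (k : R[i]) b d : P b -> P d -> P (k *: b + d).
  move=> hb hd y; rewrite (hom_linear PhiH) (hom_linear phiH) mulrDl -scalerAl.
  by rewrite -hb -hd.
have P_M b d : P b -> P d -> P (b * d).
  move=> hb hd y; by rewrite (homM PhiH) (homM phiH) -mulrA -hd -hb.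
have P1 : P 1 by move=> y; rewrite (hom1 PhiH) (hom1 phiH) mul1r.
(* Both homomorphisms are contractive, so the two errors total at most [2 * |u N - b| * |y|]. *)
have Plim (u : nat -> A) b : (forall m, P (u m)) ->
    (forall e : R, 0 < e ->
      exists N, forall m, (N <= m)%N -> cnorm (u m - b) <= e) -> P b.
  move=> Pu ub y; apply/eqP; rewrite -subr_eq0; apply/eqP; apply: cnorm_small => e e0.
  have y1 : 0 < 2 * hnorm y + 1 by rewrite ltr_wpDl ?mulr_ge0 ?hnorm_ge0.
  have [|N hN] := ub (e / (2 * hnorm y + 1)); first by rewrite divr_gt0.
  have := hN N (leqnn N); rewrite ler_pdivlMr // => h.
  have -> : Phi b y 0 - phi b * y 0 = phi (u N - b) * y 0 - Phi (u N - b) y 0.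
    rewrite (homB phiH) (homB PhiH) mulrBl -Pu.
    rewrite -[Algebra.opp (_ (_ - _) 0)]/(- (Phi (u N) y 0 - Phi b y 0)).
    by rewrite opprB [RHS]addrC addrA subrK.
  apply: (le_trans (cnormB _ _)).
  have h1 := cnormM (phi (u N - b)) (y 0); have h2 := hom_cnorm_le phiH (u N - b).
  have h3 := cnorm_le_hnorm (Phi (u N - b) y) 0; have h4 := le_opnorm (Phi (u N - b)) y.
  have h5 := hom_cnorm_le PhiH (u N - b); have h6 := cnorm_le_hnorm y 0.
  have h7 := hnorm_ge0 y; have h8 := cnorm_ge0 (u N - b).
  have h9 : cnorm (phi (u N - b)) * cnorm (y 0) <= cnorm (u N - b) * hnorm y.
    by apply: ler_pM; rewrite ?cnorm_ge0.
  have h10 : opnorm (Phi (u N - b)) * hnorm y <= cnorm (u N - b) * hnorm y.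
    by apply: ler_wpM2r.
  nra.
apply: s_gen => [|b /asboolP[h1 h2]|u b uP ub|i].
- split.
  + by apply/asboolP; rewrite star1.
  + move=> k b d /asboolP[b1 b2] /asboolP[d1 d2]; apply/asboolP.
    by rewrite starD starZ; split; exact: Plin.
  + move=> b d /asboolP[b1 b2] /asboolP[d1 d2]; apply/asboolP.
    by rewrite starM; split; exact: P_M.
- by apply/asboolP; rewrite starK.
- have {}ub := cnorm_cvg0 ub; apply/asboolP; split.
    by apply: Plim ub => m; have /asboolP[] := uP m.
  apply: (Plim (fun m => star (u m))) => [m|e /ub[N hN]].
    by have /asboolP[] := uP m.
  by exists N => m /hN; rewrite -starB cnorm_starE.
- apply/asboolP; split => y.
    by rewrite (Phi_s i y 0).1 expr0z scale1r.
  by rewrite (hom_star PhiH) (Phi_s i y 0).2 expr0z rmorph1 scale1r (hom_star phiH).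
Qed.

(** Applied to [delta 0 1], the operator [Phi a] has coefficient [phi a] at 0. *)
Lemma compression_injective : injective phi -> injective Phi.
Proof.
move=> phi_inj a b ab; apply: phi_inj.
by rewrite -[LHS]mulr1 -[RHS]mulr1 -{1 2}(deltaE 0 (1 : B)) -!coefficient0_hom ab.
Qed.

End CompressionInjective.

Lemma unital_star_hom_id (R : realType) (A : cstarAlgType R) : unital_star_hom (@id A).
Proof. by []. Qed.

Lemma unital_star_hom_comp (R : realType) (A B C : cstarAlgType R)
  (f : A -> B) (g : B -> C) :
  unital_star_hom f -> unital_star_hom g -> unital_star_hom (g \o f).
Proof.
move=> fH gH; split; last by move=> a /=; rewrite (hom_star fH) (hom_star gH).
  by move=> k a b /=; rewrite (hom_linear fH) (hom_linear gH).
split; first by rewrite /= (hom1 fH) (hom1 gH).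
by move=> a b /=; rewrite (homM fH) (homM gH).
Qed.

(** * Induction over the missing generators *)

Section Extension.
Variables (R : realType) (n : nat) (z : 'I_n -> 'I_n -> R[i]) (u : pred 'I_n).
Variables (A : cstarAlgType R) (s : 'I_n -> A).
Hypothesis A_univ : universal_cstar_algebra z u s.
Variables (n' : nat) (le_n_n' : (n <= n')%N) (z' : 'I_n' -> 'I_n' -> R[i]).
Hypothesis z'_circle : forall i j, `|z' i j| = 1.
Hypothesis z'_conj : forall i j, i != j -> z' j i = Num.conj (z' i j).
Local Notation widen := (widen_ord le_n_n').
Hypothesis z'_extends : forall i j, i != j -> z' (widen i) (widen j) = z i j.
Variable u' : pred 'I_n'.
Hypothesis u'_extends : forall i, u' (widen i) = u i.

Lemma adjoin_unitaries (m : nat) : (n <= m <= n')%N ->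
  exists (B : cstarAlgType R) (t : 'I_n' -> B) (phi : A -> B),
    [/\ unital_star_hom phi, injective phi, forall i, phi (s i) = t (widen i),
      forall i : 'I_n', (i < m)%N -> if u' i then unitary (t i) else isometry (t i) &
      forall i j : 'I_n', (i < m)%N -> (j < m)%N -> i != j ->
        star (t i) * t j = Num.conj (z' i j) *: (t j * star (t i))].
Proof.
have [[s_iso s_rel] s_gen s_univ] := A_univ.
have widenP (i : 'I_n') : (i < n)%N -> exists j, i = widen j.
  by move=> i_n; exists (Ordinal i_n); apply: val_inj.
move=> /andP[nm]; rewrite -(subnKC nm); elim: (m - n)%N => [|d IH] {nm} mn'.
  (* Indices from [n] on get the default value 0; the relations claimed concern only indices below
     [m]. *)
  rewrite addn0; pose t (i : 'I_n') : A := oapp s 0 (insub (i : nat)).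
  have tE i : t (widen i) = s i by rewrite /t (valK i).
  exists A, t, id; split; [exact: unital_star_hom_id | by [] | by move=> i; rewrite tE | |].
    by move=> ? /widenP[i ->]; rewrite u'_extends tE; exact: s_iso.
  move=> ? ? /widenP[i ->] /widenP[j ->] ij.
  by rewrite !tE z'_extends ?s_rel.
have [|B [t [phi [phiH phi_inj phi_s t_iso t_rel]]]] := IH.
  by rewrite (leq_trans _ mn') // leq_add2l.
have p_n' : (n + d < n')%N by rewrite -addnS.
pose p := Ordinal p_n'.
have /boolp.choice[T hT] (i : 'I_n') : exists T, twisted_diagonal (z' i p) (t i) T.
  exact: twisted_diagonal_exists.
have [W hW] := shift_op B.
(* [W] also fills the indices after [p], about which nothing is claimed at this stage. *)
pose t1 (i : 'I_n') : op B := if (i < n + d)%N then T i else W.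
have t1_iso (i : 'I_n') : (i < n + d.+1)%N ->
    if u' i then unitary (t1 i) else isometry (t1 i).
  move=> _; rewrite /t1; have [i_d|_] := ltnP i (n + d).
    have := t_iso i i_d; case: ifP => _.
      exact: twisted_diagonal_unitary (z'_circle i p) (hT i).
    exact: twisted_diagonal_isometry (z'_circle i p) (hT i).
  have WU : unitary W by apply: bilateral_shift_unitary hW.
  by case: ifP => _ //; case: WU.
have t1_rel (i j : 'I_n') : (i < n + d.+1)%N -> (j < n + d.+1)%N -> i != j ->
    star (t1 i) * t1 j = Num.conj (z' i j) *: (t1 j * star (t1 i)).
  have lastP (q : 'I_n') : (q < n + d.+1)%N -> ~~ (q < n + d)%N -> q = p.
    by rewrite addnS ltnS -leqNgt => h1 h2; apply/val_inj/eqP; rewrite eqn_leq h1 h2.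
  move=> i_d j_d ij; rewrite /t1; case: ifPn => [i_lt|i_ge]; case: ifPn => [j_lt|j_ge].
  - by apply: twisted_diagonal_comm (hT i) (hT j) _; exact: t_rel.
  - rewrite (lastP j j_d j_ge).
    exact: star_twisted_diagonal_shift (z'_circle i p) hW (hT i).
  (* The shift relation yields the constant [z' j p], the conjugate of [z' p j]. *)
  - rewrite (lastP i i_d i_ge) in ij *; rewrite -z'_conj //.
    exact: star_shift_twisted_diagonal (z'_circle j p) hW (hT j).
  - by move: ij; rewrite (lastP i i_d i_ge) (lastP j j_d j_ge) eqxx.
have wd (i : 'I_n) : (widen i < n + d.+1)%N by apply: ltn_addr; exact: (ltn_ord i).
have [|Phi [[PhiH Phi_s] _]] := s_univ (op B) (fun i => t1 (widen i)).
  split=> [i|i j ij]; first by have := t1_iso (widen i) (wd i); rewrite u'_extends.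
  by rewrite t1_rel ?z'_extends.
exists (op B), t1, Phi; split=> //.
apply: (compression_injective (c := fun i => z' (widen i) p) s_gen phiH PhiH) phi_inj => i.
by rewrite Phi_s phi_s /t1 (ltn_addr _ (ltn_ord i : (widen i < n)%N)); exact: hT.
Qed.

End Extension.

(** * Factorization of the injective homomorphism through [psi] *)

Theorem theorem3p1 (R : realType)
  (n : nat) (z : 'I_n -> 'I_n -> R[i])
  (z_circle : forall i j : 'I_n, `|z i j| = 1)
  (z_conj : forall i j : 'I_n, i != j -> z j i = Num.conj (z i j))
  (l : nat) (le_l_n : (l <= n)%N)
  (A : cstarAlgType R) (s : 'I_n -> A)
  (A_univ : universal_cstar_algebra z (fun i : 'I_n => (l <= i)%N) s)
  (n' : nat) (le_n_n' : (n <= n')%N) (z' : 'I_n' -> 'I_n' -> R[i])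
  (z'_circle : forall i j : 'I_n', `|z' i j| = 1)
  (z'_conj : forall i j : 'I_n', i != j -> z' j i = Num.conj (z' i j))
  (z'_extends : forall i j : 'I_n, i != j ->
     z' (widen_ord le_n_n' i) (widen_ord le_n_n' j) = z i j)
  (k : nat) (le_n_k : (n <= k)%N) (le_k_n' : (k <= n')%N)
  (A' : cstarAlgType R) (s' : 'I_n' -> A')
  (A'_univ : universal_cstar_algebra z'
     (fun i : 'I_n' => (l <= i < n)%N || (k <= i)%N) s') :
  exists psi : A -> A',
    unique (fun f : A -> A' => unital_star_hom f /\
              (forall i : 'I_n, f (s i) = s' (widen_ord le_n_n' i))) psi /\
    injective psi.
Proof.
(* Since [n <= k], an index below [n] is prescribed unitary in [A'] exactly when it is in [A]. *)
have u'E (i : 'I_n) : ((l <= widen_ord le_n_n' i < n) ||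
    (k <= widen_ord le_n_n' i))%N = (l <= i)%N.
  by rewrite /= ltn_ord andbT [(k <= i)%N]leqNgt (leq_trans (ltn_ord i) le_n_k) orbF.
have [[s_iso s_rel] s_gen s_univ] := A_univ.
have [[s'_iso s'_rel] s'_gen s'_univ] := A'_univ.
have [|psi [[psiH psi_s] psi_uniq]] :=
    s_univ A' (fun i => s' (widen_ord le_n_n' i)).
  split=> [i|i j ij]; first by have := s'_iso (widen_ord le_n_n' i); rewrite u'E.
  by rewrite s'_rel ?z'_extends // -val_eqE.
exists psi; split=> //.
have [|B [t [phi [phiH phi_inj phi_s t_iso t_rel]]]] :=
    adjoin_unitaries A_univ z'_circle z'_conj z'_extends
      (u' := fun i : 'I_n' => (l <= i < n)%N || (k <= i)%N) u'E (m := n').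
  by rewrite le_n_n' leqnn.
have [|Phi [[PhiH Phi_s'] _]] := s'_univ B t.
  by split=> [i|i j ij]; [exact: t_iso | exact: t_rel].
(* [chi] is the only homomorphism from [A] with these values on generators, so [phi] and
   [Phi \o psi] both equal it. *)
have [|chi [_ chi_uniq]] := s_univ B (fun i => t (widen_ord le_n_n' i)).
  split=> [i|i j ij]; first by have := t_iso (widen_ord le_n_n' i) (ltn_ord _); rewrite u'E.
  by rewrite t_rel ?z'_extends ?ltn_ord // -val_eqE.
have e : phi = Phi \o psi.
  rewrite -(chi_uniq phi) // -(chi_uniq (Phi \o psi)) //; split.
    exact: unital_star_hom_comp.
  by move=> i /=; rewrite psi_s Phi_s'.
by move=> a b ab; apply: phi_inj; rewrite e /= ab.
Qed.
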